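(* Let $\gamma>0$, $\sigma>0$, and consider the delay mean-field equation with infinite cut-off, i.e. $h(t)=t$. There exists $\eta_0>0$ such that the following holds. Let $A,B$ satisfy the structural assumptions stated in the context with $\alpha=1$ and constants $c_g,c_B\ge0$ such that $\eta:=c_g+2c_B\in[0,\eta_0)$, and set $$\lambda_1=\gamma-\Big(1+\frac{2\gamma}{4+\gamma^2}\Big)\eta-\frac{\gamma}{4+\gamma^2}\sqrt{4\eta^2+(4+\gamma^2)(\gamma-\eta)^2},\qquad \lambda_2=\frac{(2+\gamma)^2}{(1+\gamma)(4+\gamma^2)}\,\frac{\eta}{2},$$ and $\Lambda=\lambda_2/\lambda_1$. Then $\lambda_1>0$ and $\Lambda\in[0,1)$. Let $Z_t=(X_t,V_t)$ and $\hat Z_t=(\hat X_t,\hat V_t)$ be two solutions of the delay mean-field equation driven by the same Brownian motion, with $\mathrm{law}(Z_0),\mathrm{law}(\hat Z_0)\in\mathcal{P}_2(\mathbb{R}^{2d})$, and let $$\mathcal{J}_t=\mathbb{E}\big[Q(Z_t-\hat Z_t)\big],\qquad Q(x,v)=\Big(\frac2\gamma+\gamma\Big)|x|^2+2\langle x,v\rangle+\frac2\gamma|v|^2 .$$ Then $\mathcal{J}_t\le\phi(t)$ for all $t\ge0$, where $\phi$ is the solution of $$\frac{d\phi}{dt}(t)=-\lambda_1\phi(t)+\lambda_2\frac1t\int_0^t\phi(s)\,ds\quad(t>0),\qquad \phi(0)=\mathcal{J}_0,$$ and $\phi$ decays polynomially: $$\lim_{t\to\infty}t^{1-\Lambda}\phi(t)=\frac{\lambda_1^{\Lambda-1}}{\Gamma(\Lambda)}\,\mathcal{J}_0,$$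 where $1/\Gamma(0):=0$.
   Context: Let $d\ge2$. $\mathcal{P}_2(\mathbb{R}^{2d})$ is the set of Borel probability measures on $\mathbb{R}^{2d}$ with finite second moment; points of $\mathbb{R}^{2d}$ are written $(x,v)$ with $x,v\in\mathbb{R}^d$. $\Gamma$ is the Gamma function. Structural assumptions: (1) $A:\mathbb{R}^d\to\mathbb{R}^d$ has the form $A(x)=-\alpha x+g(x)$ with $\alpha>0$ and $g$ Lipschitz continuous with Lipschitz constant $c_g$. (2) $B:\mathbb{R}^d\times\mathbb{R}^d\to\mathbb{R}^d$ satisfies $|B(x,\hat x)-B(y,\hat x)|+|B(x,\hat x)-B(x,\hat y)|\le c_B(|x-y|+|\hat x-\hat y|)$ for all $x,\hat x,y,\hat y\in\mathbb{R}^d$. Delay mean-field equation with infinite cut-off: the McKean-type stochastic differential equation $$dX_t=V_t\,dt,\qquad dV_t=A(X_t)\,dt+\Big(\frac1t\int_0^t\int_{\mathbb{R}^d}B(X_t,\hat x)\,\rho_s(d\hat x)\,ds\Big)dt-\gamma V_t\,dt+\sqrt{2\sigma}\,dW_t,$$ where $(W_t)$ is a standard Brownian motion on $\mathbb{R}^d$, $\mu_t=\mathrm{law}(X_t,V_t)$ with $\mu\in C([0,\infty),\mathcal{P}_2(\mathbb{R}^{2d}))$, and $\rho_t$ is the first (position) marginal of $\mu_t$. The time average at $t=0$ is interpreted as its limit. For each solution, $\rho_s$ is the position marginal of that solution's own law. The solution $\phi$ is understood to be continuous on $[0,\infty)$ and differentiable on $(0,\infty)$. *)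

(* Defs.v *)
From HB Require Import structures.
From mathcomp Require Export all_boot all_order all_algebra.
From mathcomp Require Export all_classical all_reals all_analysis.

Set Implicit Arguments.
Unset Strict Implicit.
Unset Printing Implicit Defensive.

Export Order.TTheory GRing.Theory Num.Theory.
Export numFieldNormedType.Exports.

Local Open Scope classical_set_scope.
Local Open Scope ring_scope.

(* R^d with its Borel sigma-algebra. The carrier is ['rV[R]_d], on which the
   library norm is the sup norm: only the topology is taken from there, all
   estimates use the Euclidean [enorm] below. *)
Notation Rd R d := (g_sigma_algebraType (@open 'rV[R]_d)).

(* Position-velocity space, with the product of the Borel sigma-algebras, which
   is the Borel sigma-algebra of the product. *)
Notation phase R d := (Rd R d * Rd R d)%type.

HB.instance Definition _ (R : realType) (d : nat) :=
  isMeasurableFun.Build _ _ (phase R d) (Rd R d) fst measurable_fst.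

Section Euclidean.
Context {R : realType} {d : nat}.
Implicit Types (x y v : 'rV[R]_d).

Definition dotv x y : R := \sum_(i < d) x 0 i * y 0 i.

Definition enorm x : R := Num.sqrt (dotv x x).

Definition sqnorm2 (z : 'rV[R]_d * 'rV[R]_d) : R :=
  enorm z.1 ^+ 2 + enorm z.2 ^+ 2.

Definition rVint (disp : measure_display) (T : measurableType disp)
    (mu : {measure set T -> \bar R}) (D : set T) (f : T -> 'rV[R]_d)
    : 'rV[R]_d :=
  \row_i (\int[mu]_(s in D) (f s) 0 i).

(* At [t = 0] the average over [0, t] is read as its limit from the right. *)
Definition time_average (f : R -> 'rV[R]_d) (t : R) : 'rV[R]_d :=
  let m (u : R) := u^-1 *: rVint lebesgue_measure `[0, u] f in
  if t == 0 then lim (m u @[u --> 0^'+]) else m t.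

End Euclidean.

Section Structural.
Context {R : realType} {d : nat}.

Definition structuralA (alpha c_g : R) (A : 'rV[R]_d -> 'rV[R]_d) : Prop :=
  0 < alpha /\
  exists g : 'rV[R]_d -> 'rV[R]_d,
    (forall x, A x = - (alpha *: x) + g x) /\
    (forall x y, enorm (g x - g y) <= c_g * enorm (x - y)).

Definition structuralB (c_B : R) (B : 'rV[R]_d -> 'rV[R]_d -> 'rV[R]_d)
    : Prop :=
  forall x xh y yh,
    enorm (B x xh - B y xh) + enorm (B x xh - B x yh)
      <= c_B * (enorm (x - y) + enorm (xh - yh)).

End Structural.

Section Wasserstein.
Context {R : realType} {d : nat}.
Implicit Types mu nu : probability (phase R d) R.

Definition P2 : set (probability (phase R d) R) :=
  [set mu : probability (phase R d) R |
     (\int[mu]_z (sqnorm2 z)%:E < +oo)%E].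

Definition coupling mu nu : set (probability (phase R d * phase R d)%type R) :=
  [set pi | forall C : set (phase R d), measurable C ->
     pi (C `*` setT) = mu C /\ pi (setT `*` C) = nu C].

Definition W2 mu nu : \bar R :=
  (ereal_inf [set \int[pi]_p (enorm (p.1.1 - p.2.1 : 'rV[R]_d) ^+ 2
                            + enorm (p.1.2 - p.2.2 : 'rV[R]_d) ^+ 2)%:E
             | pi in coupling mu nu] `^ 2^-1)%E.

(* The space $C([0,\infty),\mathcal{P}_2)$; values at negative times are
   irrelevant. *)
Definition continuous_P2 (mu : R -> probability (phase R d) R) : Prop :=
  (forall t, 0 <= t -> P2 (mu t)) /\
  (forall t, 0 <= t ->
     W2 (mu s) (mu t) @[s --> within `[0, +oo[ (nbhs t)] --> 0%E).

Definition position_marginal mu : probability (Rd R d) R :=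
  distribution mu (fst : {mfun phase R d >-> Rd R d}).

End Wasserstein.

Section Processes.
Context {R : realType} {d : nat} {disp : measure_display}
  {T : measurableType disp} (P : probability T R).

Definition filtration (F : R -> set (set T)) : Prop :=
  [/\ forall t, 0 <= t -> sigma_algebra setT (F t),
      forall t, 0 <= t -> F t `<=` measurable
    & forall s t, 0 <= s -> s <= t -> F s `<=` F t].

Definition adapted (F : R -> set (set T)) (disp' : measure_display)
    (E : measurableType disp') (Y : R -> {RV P >-> E}) : Prop :=
  forall t, 0 <= t -> forall C : set E, measurable C -> F t (Y t @^-1` C).

Definition increment (W : R -> {RV P >-> Rd R d}) (s t : R) (w : T)
    : 'rV[R]_d := (W t w : 'rV[R]_d) - W s w.

(* Only times [0 <= t] are meaningful. The third clause says that the increment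
   has law N(0, (t - s) I_d), the fourth that it is independent of [F s];
   [normal_prob] takes the standard
   deviation as its second argument. *)
Definition brownian_motion (F : R -> set (set T))
    (W : R -> {RV P >-> Rd R d}) : Prop :=
  [/\ adapted F W,
      {ae P, forall w, (W 0 w : 'rV[R]_d) = 0 /\
         {within `[0, +oo[, continuous (fun t => W t w : 'rV[R]_d)}},
      (forall s t, 0 <= s -> s < t -> forall C : 'I_d -> set R,
         (forall i, measurable (C i)) ->
         P [set w | forall i, C i (increment W s t w 0 i)]
         = (\prod_(i < d) normal_prob 0 (Num.sqrt (t - s)) (C i))%E)
    & (forall s t, 0 <= s -> s < t ->
         forall (G : set T) (C : set (Rd R d)), F s G -> measurable C ->
         P (G `&` increment W s t @^-1` C)
         = (P G * P (increment W s t @^-1` C))%E)].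

Variables (gamma sigma : R) (A : 'rV[R]_d -> 'rV[R]_d)
  (B : 'rV[R]_d -> 'rV[R]_d -> 'rV[R]_d).

Definition law (Z : R -> {RV P >-> phase R d}) (t : R)
    : probability (phase R d) R :=
  distribution P (Z t).

Definition delay_drift (Z : R -> {RV P >-> phase R d}) (t : R) (x : 'rV[R]_d)
    : 'rV[R]_d :=
  time_average
    (fun s => rVint (position_marginal (law Z s)) setT (B x)) t.

(* The noise is additive, so the equation is stated in its pathwise integral
   form, outside one null set for all times. Each solution may come with its
   own filtration, for which [W] is a Brownian motion. *)
Definition delay_mean_field_solution (W : R -> {RV P >-> Rd R d})
    (Z : R -> {RV P >-> phase R d}) : Prop :=
  let X t w : 'rV[R]_d := (Z t w).1 in
  let V t w : 'rV[R]_d := (Z t w).2 in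
  [/\ exists F : R -> set (set T),
        [/\ filtration F, brownian_motion F W & adapted F Z],
      continuous_P2 (law Z)
    & {ae P, forall w,
        [/\ {within `[0, +oo[, continuous (X ^~ w)},
            {within `[0, +oo[, continuous (V ^~ w)}
          & forall t, 0 <= t ->
              X t w = X 0 w + rVint lebesgue_measure `[0, t] (V ^~ w) /\
              V t w = V 0 w
                + rVint lebesgue_measure `[0, t]
                    (fun s => A (X s w) + delay_drift Z s (X s w)
                              - gamma *: V s w)
                + Num.sqrt (2 * sigma) *: (W t w : 'rV[R]_d)]}].

Definition Qform (x v : 'rV[R]_d) : R :=
  (2 / gamma + gamma) * enorm x ^+ 2 + 2 * dotv x v
  + 2 / gamma * enorm v ^+ 2.

Definition Jfun (Z Zh : R -> {RV P >-> phase R d}) (t : R) : \bar R :=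
  'E_P[fun w => Qform ((Z t w).1 - (Zh t w).1) ((Z t w).2 - (Zh t w).2)].

End Processes.

Section Constants.
Context {R : realType}.

Definition lambda1 (gamma eta : R) : R :=
  gamma - (1 + 2 * gamma / (4 + gamma ^+ 2)) * eta
  - gamma / (4 + gamma ^+ 2)
    * Num.sqrt (4 * eta ^+ 2 + (4 + gamma ^+ 2) * (gamma - eta) ^+ 2).

Definition lambda2 (gamma eta : R) : R :=
  (2 + gamma) ^+ 2 / ((1 + gamma) * (4 + gamma ^+ 2)) * (eta / 2).

Definition Gamma (x : R) : R :=
  \int[lebesgue_measure]_(t in `]0, +oo[) (t `^ (x - 1) * expR (- t)).

(* $1/\Gamma$, with the convention $1/\Gamma(0) = 0$. *)
Definition inv_Gamma (x : R) : R := if x == 0 then 0 else (Gamma x)^-1.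

Definition averaged_ode (l1 l2 phi0 : R) (phi : R -> R) : Prop :=
  [/\ {within `[0, +oo[, continuous phi}, phi 0 = phi0
    & forall t : R, 0 < t ->
        is_derive t 1 phi
          (- l1 * phi t
           + l2 * (t^-1 * \int[lebesgue_measure]_(s in `[0, t]) phi s))].

End Constants.

(* Main.v *)
Require Import Defs.
From mathcomp Require Import all_boot all_order all_algebra.
From mathcomp Require Import all_classical all_reals all_analysis.
From HB Require Import structures.
From mathcomp Require Import measurable_realfun ring lra.

Set Implicit Arguments.
Unset Strict Implicit.
Unset Printing Implicit Defensive.

Import Order.TTheory GRing.Theory Num.Theory.
Import numFieldNormedType.Exports.

Local Open Scope classical_set_scope.
Local Open Scope ring_scope.

(** Under the synchronous coupling the noise cancels, so along almost every
    pair of paths Q(Z - Zh) satisfies a differential inequality in which the laws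
    enter only through the delay term.  The choice of lambda1 makes the form
    [dissipation - lambda1 Q] degenerate and positive semidefinite, and the
    difference of the two averaged interaction fields is controlled by the time
    average of J.  Gronwall's inequality is applied pathwise, against phi plus a
    constant S bounding J - phi on [0, t], and expectations are taken only
    afterwards: this gives J - phi <= Lambda S, and Lambda < 1 forces J <= phi.

    With x = lambda1 t the comparison equation is a Kummer equation and phi is,
    up to the factor J_0, the Poisson(x) mean of the coefficients
    (Lambda)_n / n!.  Tangent-line bounds on t^Lambda inside the Gamma integral
    compare Gamma(Lambda) (Lambda)_n / n! with (n + 1)^(Lambda - 1), and Jensen's
    inequality for the Poisson law carries the power law over from n to x. *)

(** The shape of the argument is dictated by what is known about J as a function of time.
    [continuous_P2] controls the law of each solution separately and not their joint law, so
    continuity of J is not at hand, only boundedness on compact intervals. Hence J is never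
    differentiated or averaged in time: along a path the delay term is bounded through the
    continuous curve phi + S, and S is a supremum that need not be attained. The drift contains a
    time average, which is well behaved only for t > 0. Derivatives are therefore taken on the open
    half-line, and continuity at 0 is supplied separately for Gronwall. The decay exponent can be
    guessed: inserting t^(-p) into the comparison equation and dropping the derivative leaves
    lambda1 = lambda2 / (1 - p), so p = 1 - Lambda. The constant in front is invisible at this level
    and comes from the explicit solution. *)

(** * The rates lambda1 and lambda2, and the quadratic forms behind them *)

Section ConstantsTheory.
Context {R : realType}.
Implicit Types gamma eta : R.

Let discr gamma eta : R := 4 * eta ^+ 2 + (4 + gamma ^+ 2) * (gamma - eta) ^+ 2.

Let discr_ge0 gamma eta : 0 <= discr gamma eta.
Proof.
by rewrite /discr; apply: addr_ge0; apply: mulr_ge0; rewrite ?sqr_ge0 ?addr_ge0 ?sqr_ge0.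
Qed.

(* [lambda1] is an eigenvalue of the dissipation form
   [2|x|^2 + 2|v|^2 - eta ((2 + 2/gamma)|x|^2 + (2/gamma)|v|^2)] relative to
   [Qform]. *)
Lemma lambda1_det0 gamma eta : 0 < gamma ->
  (2 - eta * (2 + 2 / gamma) - lambda1 gamma eta * (2 / gamma + gamma))
  * (2 - eta * (2 / gamma) - lambda1 gamma eta * (2 / gamma))
  = lambda1 gamma eta ^+ 2.
Proof.
move=> g0; have s0 : 4 + gamma ^+ 2 != 0 by nra.
rewrite /lambda1 -/(discr gamma eta).
have := sqr_sqrtr (discr_ge0 gamma eta).
set w := Num.sqrt _; rewrite {}/discr => hw.
apply/eqP; rewrite -subr_eq0; apply/eqP.
(* The square root enters the determinant condition only through its square: the two sides differ by
   a multiple of w^2 minus the radicand. *)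
transitivity ((4 + gamma ^+ 2)^-1
    * (w ^+ 2 - (4 * eta ^+ 2 + (4 + gamma ^+ 2) * (gamma - eta) ^+ 2))).
  by field; rewrite s0 gt_eqF.
by rewrite hw subrr mulr0.
Qed.

(** This is where the minus sign before the square root counts: it keeps the velocity entry 2/gamma
    (gamma - eta - lambda1) of the degenerate form nonnegative. *)
Lemma lambda1_le gamma eta : 0 < gamma -> 0 <= eta ->
  lambda1 gamma eta <= gamma - eta.
Proof.
move=> g0 e0; have s0 : 0 < 4 + gamma ^+ 2 by nra.
rewrite /lambda1 -/(discr gamma eta).
have h1 : 0 <= 2 * gamma / (4 + gamma ^+ 2) * eta.
  by rewrite mulr_ge0// divr_ge0 ?mulr_ge0 ?(ltW g0) ?(ltW s0).
have : 0 <= gamma / (4 + gamma ^+ 2) * Num.sqrt (discr gamma eta).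
  by rewrite mulr_ge0 ?sqrtr_ge0// divr_ge0 ?(ltW g0) ?(ltW s0).
rewrite mulrDl mul1r; lra.
Qed.

(** Here p, q, r stand for |x|^2, <x, v>, |v|^2. Since l^2 q^2 <= (al p)(de r), the claim is the
    arithmetic-geometric mean inequality for al p and de r; squaring avoids roots but needs the sign
    split on q. *)
Lemma quadratic_form_ge0 (al de l p q r : R) : 0 <= al -> 0 <= de -> 0 <= l ->
  al * de = l ^+ 2 -> 0 <= p -> 0 <= r -> q ^+ 2 <= p * r ->
  0 <= al * p - 2 * l * q + de * r.
Proof.
move=> al0 de0 l0 h p0 r0 hq.
suff : 2 * l * q <= al * p + de * r by lra.
have [q0|q0] := ltP q 0.
  rewrite (@le_trans _ _ 0) ?addr_ge0 ?mulr_ge0//.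
  by apply: mulr_ge0_le0; rewrite ?mulr_ge0 ?(ltW q0).
rewrite -ler_sqr ?nnegrE ?addr_ge0 ?mulr_ge0//.
have H1 : (2 * l * q) ^+ 2 <= 4 * (al * p) * (de * r).
  have -> : (2 * l * q) ^+ 2 = 4 * l ^+ 2 * q ^+ 2 by ring.
  have -> : 4 * (al * p) * (de * r) = 4 * (al * de) * (p * r) by ring.
  by rewrite h; apply: ler_wpM2l => //; rewrite mulr_ge0 ?sqr_ge0.
apply: (le_trans H1).
rewrite -subr_ge0.
have -> : (al * p + de * r) ^+ 2 - 4 * (al * p) * (de * r)
  = (al * p - de * r) ^+ 2 by ring.
exact: sqr_ge0.
Qed.

(** Right side minus left side is the form whose diagonal entries are the two factors in
    [lambda1_det0] and whose off-diagonal entry is - lambda1. The velocity entry is nonnegative by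
    [lambda1_le]; the position entry then is too, because the product of the two is lambda1^2 >
    0. *)
Lemma lambda1_dissipation gamma eta (p q r : R) : 0 < gamma -> 0 <= eta ->
  0 < lambda1 gamma eta -> 0 <= p -> 0 <= r -> q ^+ 2 <= p * r ->
  lambda1 gamma eta * ((2 / gamma + gamma) * p + 2 * q + 2 / gamma * r)
  <= 2 * p + 2 * r - eta * ((2 + 2 / gamma) * p + 2 / gamma * r).
Proof.
move=> g0 e0 l0 p0 r0 hq.
have hde := lambda1_det0 eta g0.
have hl := lambda1_le g0 e0.
move: hde hl l0; set l := lambda1 _ _ => hde hl l0.
set al := (X in X * _ = _) in hde.
set de := (X in _ * X = _) in hde.
have de0 : 0 <= de.
  have -> : de = 2 / gamma * (gamma - eta - l) by rewrite /de; field; rewrite gt_eqF.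
  by rewrite mulr_ge0 ?subr_ge0 ?divr_ge0 ?(ltW g0).
have al0 : 0 <= al.
  have : 0 < al * de by rewrite hde exprn_gt0.
  move: de0; rewrite le_eqVlt => /orP[/eqP <-|d0]; first by rewrite mulr0 ltxx.
  by rewrite pmulr_lgt0// => /ltW.
have := quadratic_form_ge0 al0 de0 (ltW l0) hde p0 r0 hq.
rewrite /al /de -subr_ge0 => H; rewrite -subr_ge0.
by apply: le_trans H _; rewrite le_eqVlt; apply/orP; left; apply/eqP; ring.
Qed.

(** The inverse constant (4 + gamma^2) / (2 gamma) is the Schur complement of the velocity entry of
    Q: minimising Q over v leaves this multiple of |x|^2. *)
Lemma Qform_bound gamma (p q r : R) : 0 < gamma -> 0 <= p -> 0 <= r ->
  q ^+ 2 <= p * r ->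
  p <= 2 * gamma / (4 + gamma ^+ 2)
       * ((2 / gamma + gamma) * p + 2 * q + 2 / gamma * r).
Proof.
move=> g0 p0 r0 hq.
have s0 : 0 < 4 + gamma ^+ 2 by nra.
have K0 : 0 <= 2 * gamma / (4 + gamma ^+ 2) by rewrite divr_ge0 ?mulr_ge0 ?ltW.
rewrite -subr_ge0.
(* What remains has diagonal entries gamma/2 and 2/gamma, with product 1, so it is degenerate with l
   = 1 and q replaced by - q. *)
have -> : 2 * gamma / (4 + gamma ^+ 2) *
    ((2 / gamma + gamma) * p + 2 * q + 2 / gamma * r) - p =
    2 * gamma / (4 + gamma ^+ 2) * (gamma / 2 * p - 2 * 1 * (- q) + 2 / gamma * r).
  by field; rewrite !gt_eqF.
apply: mulr_ge0 => //; apply: quadratic_form_ge0 => //.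
- by rewrite divr_ge0 ?ltW.
- by rewrite divr_ge0 ?ltW.
- by field; rewrite gt_eqF.
- by rewrite sqrrN.
Qed.

Lemma lambda2_ge0 gamma eta : 0 < gamma -> 0 <= eta -> 0 <= lambda2 gamma eta.
Proof.
move=> g0 e0; rewrite /lambda2 mulr_ge0 ?divr_ge0 ?mulr_ge0 ?addr_ge0 ?sqr_ge0 ?(ltW g0)//.
Qed.

(** For eta < gamma the radicand is at most (2 eta + s gamma)^2, which makes lambda1 - lambda2 at
    least the affine function kap - C eta, where kap is lambda1 at eta = 0. *)
Lemma small_eta gamma : 0 < gamma -> exists2 eta0 : R, 0 < eta0 &
  forall eta, 0 <= eta -> eta < eta0 ->
  0 < lambda1 gamma eta /\ lambda2 gamma eta < lambda1 gamma eta.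
Proof.
move=> g0.
have s0 : 0 < 4 + gamma ^+ 2 by nra.
set s := Num.sqrt (4 + gamma ^+ 2).
have hs : s ^+ 2 = 4 + gamma ^+ 2 by rewrite sqr_sqrtr ?ltW.
have sp : 0 < s by rewrite sqrtr_gt0.
have sg : gamma < s by rewrite -ltr_sqr ?nnegrE ?ltW// hs ltrDr.
pose kap := gamma - gamma ^+ 2 / s.
have kap0 : 0 < kap.
  rewrite /kap subr_gt0 ltr_pdivrMr// expr2 ltr_pM2l//.
pose c2 := (2 + gamma) ^+ 2 / ((1 + gamma) * (4 + gamma ^+ 2)) / 2.
have c20 : 0 <= c2.
  by rewrite /c2 !divr_ge0 ?mulr_ge0 ?addr_ge0 ?sqr_ge0 ?(ltW g0).
pose C := 1 + 4 * gamma / (4 + gamma ^+ 2) + c2.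
have C0 : 0 < C.
  rewrite /C -addrA ltr_wpDr// addr_ge0// divr_ge0 ?mulr_ge0 ?ltW//.
(* [kap / C] is the zero of the affine lower bound; the cap at [gamma] gives (gamma - eta)^2 <=
   gamma^2. *)
exists (Num.min gamma (kap / C)); first by rewrite lt_min g0 divr_gt0.
move=> eta e0; rewrite lt_min => /andP[eg eC].
have key : lambda2 gamma eta < lambda1 gamma eta.
  have hw : Num.sqrt (4 * eta ^+ 2 + (4 + gamma ^+ 2) * (gamma - eta) ^+ 2)
      <= 2 * eta + s * gamma.
    have h0 : 0 <= 2 * eta + s * gamma by rewrite addr_ge0 ?mulr_ge0 ?(ltW sp) ?(ltW g0).
    rewrite -[leRHS]ger0_norm// -sqrtr_sqr ler_wsqrtr// -hs.
    have : (gamma - eta) ^+ 2 <= gamma ^+ 2 by rewrite ler_sqr ?nnegrE ?subr_ge0 ?(ltW eg) ?(ltW g0)// gerBl.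
    move=> h1.
    have : s ^+ 2 * (gamma - eta) ^+ 2 <= s ^+ 2 * gamma ^+ 2 by rewrite ler_wpM2l ?sqr_ge0.
    have : 0 <= 4 * eta * (s * gamma) by rewrite !mulr_ge0 ?(ltW sp) ?(ltW g0).
    nra.
  have -> : lambda2 gamma eta = c2 * eta by rewrite /lambda2 /c2; ring.
  have hx : gamma / (4 + gamma ^+ 2) * Num.sqrt (4 * eta ^+ 2 + (4 + gamma ^+ 2) * (gamma - eta) ^+ 2)
       <= gamma / (4 + gamma ^+ 2) * (2 * eta + s * gamma).
    by rewrite ler_wpM2l// divr_ge0 ?ltW.
  move: eC; rewrite ltr_pdivlMr// => eC.
  apply: (@lt_le_trans _ _ (gamma - (1 + 2 * gamma / (4 + gamma ^+ 2)) * eta -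
     gamma / (4 + gamma ^+ 2) * (2 * eta + s * gamma))); last first.
    by rewrite /lambda1 lerD2l lerN2.
  rewrite -subr_gt0.
  have -> : gamma - (1 + 2 * gamma / (4 + gamma ^+ 2)) * eta -
     gamma / (4 + gamma ^+ 2) * (2 * eta + s * gamma) - c2 * eta = kap - eta * C.
    rewrite /C /kap -hs; field; rewrite gt_eqF//.
  by rewrite subr_gt0.
by split=> //; apply: le_lt_trans key; apply: lambda2_ge0.
Qed.

End ConstantsTheory.

(** * Gronwall's inequality, and uniqueness for the averaged equation *)

Section Gronwall.
Context {R : realType}.
Implicit Types f : R -> R.

Lemma is_derive1_scale f (k x l : R) : is_derive (k * x) 1 f l ->
  is_derive x 1 (fun t => f (k * t)) (k * l).
Proof.
move=> fl; rewrite mulrC; apply: (@is_derive1_comp _ f (fun t => k * t)) => //.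
apply: (is_derive_eq (@is_deriveM _ _ (cst k) id x 1 0 1 _ _)).
by rewrite scaler0 addr0 /GRing.scale/= mulr1.
Qed.

Lemma is_derive_expR_scale (k x : R) :
  is_derive x 1 (fun t => expR (k * t)) (k * expR (k * x)).
Proof. exact: is_derive1_scale. Qed.

(** C = l2 / l1 * S is the rest point of f' = - l1 f + l2 S, so exp(l1 t) (f - C) is
    nonincreasing. *)
Lemma linear_gronwall (l1 l2 S T : R) (f f' : R -> R) :
  0 < l1 -> 0 <= T -> {within `[0, T], continuous f} ->
  (forall t, 0 < t < T -> is_derive t 1 f (f' t)) ->
  (forall t, 0 < t < T -> f' t <= - l1 * f t + l2 * S) ->
  f T <= expR (- l1 * T) * f 0 + (1 - expR (- l1 * T)) * (l2 / l1 * S).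
Proof.
move=> l10 T0 cf df lef.
pose C := l2 / l1 * S.
pose h t := expR (l1 * t) * (f t - C).
have dh t : 0 < t < T ->
    is_derive t 1 h (expR (l1 * t) * (f' t + l1 * (f t - C))).
  move=> /df dft.
  apply: (is_derive_eq (@is_deriveM _ _ (fun t => expR (l1 * t)) (fun t => f t - C) t 1 _ _
    (is_derive_expR_scale l1 t) (is_deriveB dft (is_derive_cst C t 1)))).
  by rewrite /GRing.scale/=; ring.
have ch : {within `[0, T], continuous h}.
  move=> x; apply: cvgM.
    apply: (@continuous_subspaceT _ _ _ (fun t => expR (l1 * t))) => y.
    apply: (@cvg_comp _ _ _ ( *%R l1) expR _ (nbhs (l1 * y))).
      by apply: cvgM; [exact: cvg_cst|exact: cvg_id].
    exact: continuous_expR.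
  by apply: cvgB; [exact: cf|exact: cvg_cst].
have : h T <= h 0.
  apply: (@ler0_derive1_le_cc _ h 0 T) => //.
  - by move=> x; rewrite in_itv/= => /dh[].
  - move=> x; rewrite in_itv/= => xT; have [_] := dh _ xT.
    rewrite -derive1E => ->; rewrite pmulr_rle0 ?expR_gt0//.
    have := lef _ xT; rewrite -lerBlDl => H.
    have -> : f' x + l1 * (f x - C) = f' x + l1 * f x - l2 * S.
      by rewrite /C; field; rewrite gt_eqF.
    lra.
  - by rewrite in_itv/= lexx T0.
  - by rewrite in_itv/= lexx T0.
rewrite /h mulr0 expR0 mul1r -/C mulNr expRN => H.
have e0 := expR_gt0 (l1 * T).
rewrite -(@ler_pM2l _ (expR (l1 * T)))//.
have -> : expR (l1 * T) * ((expR (l1 * T))^-1 * f 0 + (1 - (expR (l1 * T))^-1) * C)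
  = f 0 - C + expR (l1 * T) * C by field; rewrite gt_eqF.
by rewrite -lerBlDr -mulrBr.
Qed.

Lemma continuous_itv_integrable f t : {within `[0, t], continuous f} ->
  (@lebesgue_measure R).-integrable `[0, t] (EFin \o f).
Proof. by move=> cf; apply: continuous_compact_integrable => //; exact: segment_compact. Qed.

Lemma Rintegral0_cst t (c : R) : 0 <= t ->
  \int[lebesgue_measure]_(s in `[0, t]) c = t * c.
Proof.
move=> t0; rewrite Rintegral_cst//= lebesgue_measure_itv/= lte_fin mulrC.
by move: t0; rewrite le_eqVlt => /orP[/eqP <-|->]; rewrite ?ltxx//= oppr0 addr0.
Qed.

Lemma average_le_cst f t c : 0 < t -> {within `[0, t], continuous f} ->
  (forall s, 0 <= s <= t -> f s <= c) ->
  t^-1 * \int[lebesgue_measure]_(s in `[0, t]) f s <= c.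
Proof.
move=> t0 cf fc; rewrite mulrC ler_pdivrMr// mulrC -(Rintegral0_cst c (ltW t0)).
apply: le_Rintegral => //=; first exact: continuous_itv_integrable.
  apply: continuous_itv_integrable => x; exact: cvg_cst.
Qed.

(** The average of psi - phi is at most S, so the gap obeys the linear inequality with zero initial
    value. The bound is one-sided so that the two solutions can be exchanged. *)
Lemma averaged_ode_gap (l1 l2 a S T : R) (phi psi : R -> R) :
  0 < l1 -> 0 <= l2 -> 0 <= S -> 0 <= T ->
  averaged_ode l1 l2 a phi -> averaged_ode l1 l2 a psi ->
  (forall s, 0 <= s <= T -> psi s - phi s <= S) ->
  psi T - phi T <= l2 / l1 * S.
Proof.
move=> l10 l20 S0 T0 [cphi phi0 dphi] [cpsi psi0 dpsi] gap.
have cw t f : {within `[0, +oo[, continuous f} -> {within `[0, t], continuous f}.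
  by apply: continuous_subspaceW => x/=; rewrite !in_itv/= => /andP[->].
have cdiff t : {within `[0, t], continuous (psi \- phi)}.
  by move=> x; apply: cvgB; apply: cw.
pose f' t := - l1 * psi t + l2 * (t^-1 * \int[lebesgue_measure]_(s in `[0, t]) psi s) -
    (- l1 * phi t + l2 * (t^-1 * \int[lebesgue_measure]_(s in `[0, t]) phi s)).
have df t : 0 < t < T -> is_derive t 1 (psi \- phi) (f' t).
  by move=> /andP[tp _]; exact: is_deriveB (dpsi t tp) (dphi t tp).
have := @linear_gronwall l1 l2 S T (psi \- phi) f' l10 T0 (cdiff T) df.
rewrite /= psi0 phi0 subrr mulr0 add0r => H.
apply: le_trans (H _) _.
  move=> t /andP[tp tT].
  rewrite /f' opprD addrACA -mulrBr -mulrBr -mulrBr lerD2l ler_wpM2l//.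
  rewrite -RintegralB//; [|exact/continuous_itv_integrable/cw..].
  apply: average_le_cst => // s /andP[s0 st]; apply: gap.
  by rewrite s0 (le_trans st) ?(ltW tT).
rewrite ler_piMl// ?gerBl ?expR_ge0// mulr_ge0// divr_ge0// ltW//.
Qed.

Lemma averaged_ode_unique (l1 l2 a : R) (phi psi : R -> R) :
  0 < l1 -> 0 <= l2 -> l2 < l1 ->
  averaged_ode l1 l2 a phi -> averaged_ode l1 l2 a psi ->
  forall t, 0 <= t -> psi t = phi t.
Proof.
move=> l10 l20 l21 ophi opsi t t0.
have ct : {within `[0, t], continuous (fun s => `|psi s - phi s|)}.
  have sub f : {within `[0, +oo[, continuous f} -> {within `[0, t], continuous f}.
    by apply: continuous_subspaceW => x/=; rewrite !in_itv/= => /andP[->].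
  case: ophi => /sub cphi _ _; case: opsi => /sub cpsi _ _.
  by move=> x; apply: cvg_norm; apply: cvgB; [exact: cpsi|exact: cphi].
(* The contraction is used at a maximiser c of the distance, where it reads S <= (l2 / l1) S and
   forces S = 0; the sign of psi - phi at c decides the order of the solutions. *)
have [c] := EVT_max t0 ct.
rewrite in_itv/= => /andP[c0 ct'] cmax.
set S := `|psi c - phi c| in cmax.
have gap s : 0 <= s <= t -> `|psi s - phi s| <= S.
  by move=> st; apply: cmax; rewrite in_itv.
have S0 : 0 <= S by exact: normr_ge0.
have cs s : 0 <= s <= c -> 0 <= s <= t.
  by move=> /andP[-> /le_trans->].
have : S <= l2 / l1 * S.
  rewrite {1}/S; have [h|h] := leP 0 (psi c - phi c).
    rewrite ger0_norm//; apply: averaged_ode_gap ophi opsi _ => // s sc.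
    by apply: le_trans (gap _ (cs _ sc)); exact: ler_norm.
  rewrite ltr0_norm// opprB; apply: averaged_ode_gap opsi ophi _ => // s sc.
  by apply: le_trans (gap _ (cs _ sc)); rewrite distrC; exact: ler_norm.
rewrite -subr_le0 -{1}[S]mul1r -mulrBl => H.
have S00 : S <= 0.
  move: H; rewrite pmulr_rle0// subr_gt0 ltr_pdivrMr// mul1r//.
apply/eqP; rewrite -subr_eq0 -normr_le0.
by apply: le_trans (gap t _) S00; rewrite t0 lexx.
Qed.

End Gronwall.

(** * Poisson means of sequences: calculus in the parameter *)

Section Poisson.
Context {R : realType}.
Implicit Types (a b : nat -> R) (x : R).

Definition poisson_mean a x : R :=
  expR (- x) * limn (pseries (fun n => a n / n`!%:R) x).

(** A geometric bound survives shifts of the index and, after division by n!, gives convergence for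
    every x by comparison with the exponential series at 2|x|. Base 2 already dominates n + 1. *)
Definition exp_growth a := exists C, forall n, `|a n| <= C * 2 ^+ n.

Lemma exp_growth_cvg a x : exp_growth a ->
  cvgn (pseries (fun n => a n / n`!%:R) x).
Proof.
move=> [C aC]; apply: normed_cvg.
have C0 : 0 <= C by have := aC 0%N; rewrite expr0 mulr1; apply: le_trans.
apply: (@series_le_cvg _ _ (C *: exp_coeff (2 * `|x|))) => //.
- by move=> n; rewrite normr_ge0.
- move=> n; rewrite /exp_coeff /GRing.scale/=.
  by rewrite mulr_ge0// divr_ge0// exprn_ge0// mulr_ge0.
- move=> n; rewrite /exp_coeff /GRing.scale/=.
  rewrite !normrM normfV normrX exprMn (@ger0_norm _ n`!%:R)//.
  rewrite -[leRHS]/(C * _) !mulrA [leLHS]mulrAC ler_wpM2r// ler_wpM2r ?exprn_ge0//.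
- by apply: is_cvg_seriesZ; exact: is_cvg_series_exp_coeff.
Qed.

Lemma exp_growth_shift a : exp_growth a -> exp_growth (fun n => a n.+1).
Proof.
by move=> [C aC]; exists (C * 2) => n; rewrite -mulrA -exprS.
Qed.

Lemma exp_growthD a b k : exp_growth a -> exp_growth b ->
  exp_growth (fun n => a n + k * b n).
Proof.
move=> [C aC] [D bD]; exists (C + `|k| * D) => n.
rewrite mulrDl (le_trans (ler_normD _ _))// lerD// normrM -mulrA.
by rewrite ler_wpM2l.
Qed.

Lemma exp_growth_le a C : (forall n, `|a n| <= C * n.+1%:R) -> exp_growth a.
Proof.
move=> aC; exists C => n; rewrite (le_trans (aC n))// ler_wpM2l//.
  by have := aC 0%N; rewrite mulr1; apply: le_trans.
by rewrite -natrX ler_nat ltn_expl.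
Qed.

Lemma poisson_mean_le a b x : 0 <= x -> exp_growth a -> exp_growth b ->
  (forall n, a n <= b n) -> poisson_mean a x <= poisson_mean b x.
Proof.
move=> x0 ga gb ab; rewrite ler_wpM2l ?expR_ge0//.
apply: lim_series_le; [exact: exp_growth_cvg|exact: exp_growth_cvg|].
by move=> n; rewrite ler_wpM2r ?exprn_ge0// ler_wpM2r.
Qed.

Lemma poisson_meanD a b k x : exp_growth a -> exp_growth b ->
  poisson_mean (fun n => a n + k * b n) x = poisson_mean a x + k * poisson_mean b x.
Proof.
move=> ga gb; rewrite /poisson_mean [k * _]mulrCA -mulrDr; congr (_ * _).
have ca := exp_growth_cvg (x := x) ga; have cb := exp_growth_cvg (x := x) gb.
have -> : k * limn (pseries (fun n => b n / n`!%:R) x) =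
   k *: limn (pseries (fun n => b n / n`!%:R) x) by [].
rewrite -lim_seriesZ// -lim_seriesD//; last exact: is_cvg_seriesZ.
congr (limn (series _)); apply/funext => n /=.
by rewrite !fctE /GRing.scale/=; ring.
Qed.

Lemma poisson_meanZ a k x : exp_growth a ->
  poisson_mean (fun n => k * a n) x = k * poisson_mean a x.
Proof.
move=> ga; rewrite /poisson_mean [k * _]mulrCA; congr (_ * _).
rewrite -[RHS]/(k *: _) -lim_seriesZ; last exact: exp_growth_cvg.
congr (limn (series _)); apply/funext => n /=.
by rewrite !fctE /GRing.scale/=; ring.
Qed.

Lemma poisson_mean1 x : poisson_mean (fun=> 1) x = 1.
Proof.
rewrite /poisson_mean (_ : limn _ = expR x) ?expRN ?mulVf ?gt_eqF ?expR_gt0//.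
rewrite /expR; congr (limn (series _)); apply/funext => n /=.
by rewrite /exp_coeff/= mul1r mulrC.
Qed.

Lemma poisson_mean0 a : poisson_mean a 0 = a 0%N.
Proof.
rewrite /poisson_mean oppr0 expR0 mul1r.
apply: lim_near_cst => //; near=> m; rewrite -[m]prednK; last by near: m.
rewrite /pseries /series/= big_nat_recl// expr0 fact0 divr1 mulr1 big1 ?addr0// => i _.
by rewrite expr0n mulr0.
Unshelve. all: by end_near. Qed.

(** The Stein-Chen identity E[N a(N - 1)] = x E[a(N)]. At n = 0 the value of [a n.-1] is immaterial
    because of the factor n. *)
Lemma poisson_mean_pred a x : exp_growth a ->
  poisson_mean (fun n => n%:R * a n.-1) x = x * poisson_mean a x.
Proof.
move=> ga; rewrite /poisson_mean [x * _]mulrCA; congr (_ * _).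
have ca := exp_growth_cvg (x := x) ga.
apply/cvg_lim => //; rewrite -cvg_shiftS.
rewrite [X in X @ _ --> _](_ : _ = fun n => x * pseries (fun n => a n / n`!%:R) x n).
  by apply: cvgM => //; exact: cvg_cst.
apply/funext => n; rewrite /pseries /series/= big_nat_recl//.
rewrite !mul0r add0r mulr_sumr; apply: eq_bigr => i _.
rewrite factS natrM exprS; field.
by rewrite nat1r !pnatr_eq0 -lt0n fact_gt0.
Qed.

(** Differentiating an exponential generating series shifts its coefficients, and exp(-x)
    contributes the minus sign: the derivative is the Poisson mean of the forward difference. *)
Lemma poisson_mean_derive a x : exp_growth a ->
  is_derive x 1 (poisson_mean a) (poisson_mean (fun n => a n.+1) x - poisson_mean a x).
Proof.
move=> ga.
have dfs b : pseries_diffs (fun n => b n / n`!%:R) = (fun n => b n.+1 / n`!%:R) :> (nat -> R).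
  apply/funext => n; rewrite /pseries_diffs factS natrM; field.
  by rewrite nat1r !pnatr_eq0 -lt0n fact_gt0.
have := @pseries_snd_diffs R (fun n => a n / n`!%:R) (`|x| + 1) x.
rewrite !dfs => H.
have {}H : is_derive x 1 (fun x => limn (pseries (fun n => a n / n`!%:R) x))
   (limn (pseries (fun n => a n.+1 / n`!%:R) x)).
  apply: H; [exact: exp_growth_cvg|..].
  - exact/exp_growth_cvg/exp_growth_shift.
  - exact/exp_growth_cvg/(exp_growth_shift (exp_growth_shift ga)).
  - by rewrite [ltRHS]ger0_norm ?ltrDl// addr_ge0.
have E : is_derive x 1 (fun t : R => expR (- t)) (- expR (- x)).
  have := is_derive_expR_scale (-1) x.
  by rewrite !mulN1r; under eq_fun do rewrite mulN1r.
apply: (is_derive_eq (is_deriveM E H)).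
by rewrite /GRing.scale/= /poisson_mean; ring.
Qed.

End Poisson.

(** * Explicit solution of the averaged equation *)

Section AveragedOde.
Context {R : realType}.
Implicit Types (L x : R).

(** (L)_n / n!, with (L)_n the Pochhammer symbol. *)
Definition rising L n : R := \prod_(i < n) ((L + i%:R) / i.+1%:R).

(** (L + 1)_n / (n + 1)!, that is [rising L n.+1] divided by L, in a form that also makes sense for
    L = 0. *)
Definition rising_tail L n : R := \prod_(i < n) ((L + i.+1%:R) / i.+2%:R).

Lemma risingS L n : rising L n.+1 = L * rising_tail L n.
Proof.
rewrite /rising /rising_tail; elim: n => [|n IH].
  by rewrite big_ord_recr !big_ord0 /= addr0 divr1 mul1r mulr1.
by rewrite big_ord_recr/= IH [in RHS]big_ord_recr/= [RHS]mulrA.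
Qed.

(** Telescoped: [rising_tail L n] is the arithmetic mean of [rising L 0], ..., [rising L n]. This is
    the discrete counterpart of the time average in the equation. *)
Lemma rising_recl L n : n.+1%:R * rising_tail L n = n%:R * rising_tail L n.-1 + rising L n.
Proof.
case: n => [|n]; first by rewrite /rising_tail /rising !big_ord0 mul0r add0r mulr1.
rewrite risingS /= {1}/rising_tail big_ord_recr/= -/(rising_tail L n).
by rewrite mulrCA [n.+2%:R * _]mulrC divfK ?pnatr_eq0//; ring.
Qed.

Lemma rising_ge0 L n : 0 <= L -> 0 <= rising L n.
Proof. by move=> L0; apply: prodr_ge0 => i _; rewrite divr_ge0// addr_ge0. Qed.

Lemma rising_tail_ge0 L n : 0 <= L -> 0 <= rising_tail L n.
Proof. by move=> L0; apply: prodr_ge0 => i _; rewrite divr_ge0// addr_ge0. Qed.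

Lemma rising_le1 L n : 0 <= L <= 1 -> rising L n <= 1.
Proof.
move=> /andP[L0 L1]; apply: prodr_ile1 => i _.
by rewrite divr_ge0 ?addr_ge0//= ler_pdivrMr// mul1r -nat1r lerD2r.
Qed.

Lemma rising_tail_le1 L n : 0 <= L <= 1 -> rising_tail L n <= 1.
Proof.
move=> /andP[L0 L1]; apply: prodr_ile1 => i _.
by rewrite divr_ge0//= ?addr_ge0// ler_pdivrMr// mul1r -[leRHS]nat1r lerD2r.
Qed.

Lemma rising_growth L : 0 <= L <= 1 -> exp_growth (rising L).
Proof.
move=> L01; apply: (@exp_growth_le _ _ 1) => n.
rewrite ger0_norm ?rising_ge0//; last by case/andP: L01.
by rewrite mul1r (le_trans (rising_le1 _ L01))// ler1n.
Qed.

Lemma rising_tail_growth L : 0 <= L <= 1 -> exp_growth (rising_tail L).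
Proof.
move=> L01; apply: (@exp_growth_le _ _ 1) => n.
rewrite ger0_norm ?rising_tail_ge0//; last by case/andP: L01.
by rewrite mul1r (le_trans (rising_tail_le1 _ L01))// ler1n.
Qed.

Lemma rising_sum_growth L : 0 <= L <= 1 ->
  exp_growth (fun n => n%:R * rising_tail L n.-1).
Proof.
move=> L01; apply: (@exp_growth_le _ _ 1) => n.
rewrite ger0_norm ?mulr_ge0 ?rising_tail_ge0//; last by case/andP: L01.
rewrite mul1r (@le_trans _ _ n%:R)// ?ler_nat//.
by rewrite ler_piMr// rising_tail_le1.
Qed.

(* $e^{-x} M(\Lambda, 1, x)$ with $x = \lambda_1 t$ and $M$ Kummer's function *)
Definition averaged_ode_sol (l1 l2 a t : R) : R :=
  a * poisson_mean (rising (l2 / l1)) (l1 * t).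

Lemma is_derive_poisson_mean_scale a (k t : R) : exp_growth a ->
  is_derive t 1 (fun t => poisson_mean a (k * t))
    (k * (poisson_mean (fun n => a n.+1) (k * t) - poisson_mean a (k * t))).
Proof. by move=> ga; exact/is_derive1_scale/poisson_mean_derive. Qed.

Lemma is_derive_continuous (f : R -> R) x l : is_derive x 1 f l -> {for x, continuous f}.
Proof. by move=> [df _]; apply: differentiable_continuous; exact/derivable1_diffP. Qed.

Lemma averaged_ode_sol_average (l1 l2 a t : R) : 0 < l1 -> 0 <= l2 <= l1 -> 0 < t ->
  t^-1 * \int[lebesgue_measure]_(s in `[0, t]) averaged_ode_sol l1 l2 a s =
  a * poisson_mean (rising_tail (l2 / l1)) (l1 * t).
Proof.
move=> l10 /andP[l20 l21] t0; set L := l2 / l1.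
have L01 : 0 <= L <= 1.
  by rewrite /L divr_ge0 ?(ltW l10)//= ler_pdivrMr// mul1r.
(* An antiderivative of the solution: the sequence n [rising_tail L n.-1] has forward difference
   [rising L n], and 1 / l1 offsets the chain rule. By [poisson_mean_pred] its value at t is t times
   the claimed average. *)
pose F s := a / l1 * poisson_mean (fun n => n%:R * rising_tail L n.-1) (l1 * s).
have dF (s : R) : is_derive s 1 F (averaged_ode_sol l1 l2 a s).
  have := is_deriveZ (a / l1) (is_derive_poisson_mean_scale l1 s (rising_sum_growth L01)).
  move/is_derive_eq; apply.
  rewrite /averaged_ode_sol -/L /GRing.scale/=.
  have -> : (fun n => n.+1%:R * rising_tail L n.+1.-1) =
      (fun n => n%:R * rising_tail L n.-1 + 1 * rising L n).
    by apply/funext => n; rewrite rising_recl mul1r.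
  rewrite poisson_meanD; [|exact: rising_sum_growth|exact: rising_growth].
  by field; rewrite gt_eqF.
rewrite /Rintegral (@continuous_FTC2 _ _ F)//.
- rewrite -EFinB/= /F mulr0 poisson_mean0 mul0r mulr0 subr0.
  rewrite poisson_mean_pred; last exact: rising_tail_growth.
  by field; rewrite !gt_eqF.
- apply: continuous_subspaceT => s.
  exact: (is_derive_continuous (is_deriveZ a (is_derive_poisson_mean_scale l1 s (rising_growth L01)))).
- split.
  + by move=> s _; have [] := dF s.
  + by apply: cvg_at_right_filter; exact: is_derive_continuous (dF _).
  + by apply: cvg_at_left_filter; exact: is_derive_continuous (dF _).
- by move=> s _; rewrite derive1E; have [_ ->] := dF s.
Qed.

(** The derivative involves the mean of [rising] shifted by one, which by [risingS] is L times the
    mean of [rising_tail], hence L times the time average; and l1 L = l2. *)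
Lemma averaged_ode_solP (l1 l2 a : R) : 0 < l1 -> 0 <= l2 <= l1 ->
  averaged_ode l1 l2 a (averaged_ode_sol l1 l2 a).
Proof.
move=> l10 l2l1; have L01 : 0 <= l2 / l1 <= 1.
  by case/andP: l2l1 => l20 l21; rewrite divr_ge0 ?(ltW l10)//= ler_pdivrMr// mul1r.
have dsol (t : R) : is_derive t 1 (averaged_ode_sol l1 l2 a)
    (a * (l1 * (poisson_mean (fun n => rising (l2 / l1) n.+1) (l1 * t) -
       poisson_mean (rising (l2 / l1)) (l1 * t)))).
  exact: is_deriveZ (is_derive_poisson_mean_scale l1 t (rising_growth L01)).
split.
- by apply: continuous_subspaceT => t; exact: is_derive_continuous (dsol t).
- by rewrite /averaged_ode_sol mulr0 poisson_mean0 /rising big_ord0 mulr1.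
- move=> t t0; rewrite averaged_ode_sol_average//.
  apply: (is_derive_eq (dsol t)).
  rewrite (_ : (fun n => _) = (fun n => l2 / l1 * rising_tail (l2 / l1) n)); last first.
    by apply/funext => n; rewrite risingS.
  rewrite poisson_meanZ; last exact: rising_tail_growth.
  by rewrite /averaged_ode_sol; field; rewrite gt_eqF.
Qed.

End AveragedOde.

(** * Tangent-line bounds for powers, and Poisson means of the coefficients *)

Section Tangent.
Context {R : realType}.
Implicit Types (p u x y z L : R).

(** With w = 1 - p + p u, apply ln y <= y - 1 at y = u / w and y = 1 / w with weights p and 1 - p:
    the right sides add up to zero, leaving p ln u <= ln w. *)
Lemma powR_le_tangent1 p u : 0 <= p <= 1 -> 0 < u -> u `^ p <= 1 + p * (u - 1).
Proof.
move=> /andP[p0 p1] u0; set w := 1 + p * (u - 1).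
have v0 : 0 < w.
  have -> : w = (1 - p) + p * u by rewrite /w; ring.
  move: p1; rewrite le_eqVlt => /orP[/eqP ->|p1]; first by rewrite subrr add0r mul1r.
  by rewrite ltr_wpDr ?subr_gt0// mulr_ge0// ltW.
rewrite -ler_ln ?posrE ?powR_gt0// ln_powR.
have lnle y : 0 < y -> ln y <= y - 1.
  by move=> y0; have := @le_ln1Dx _ (y - 1); rewrite [1 + _]addrC subrK; apply; rewrite ltrBrDr addNr.
have h1 := lnle _ (divr_gt0 u0 v0).
have h2 : ln w^-1 <= w^-1 - 1 by apply: lnle; rewrite invr_gt0.
rewrite ln_div ?posrE// in h1; rewrite lnV ?posrE// in h2.
have h3 : p * (ln u - ln w) <= p * (u / w - 1) by rewrite ler_wpM2l.
have h4 : (1 - p) * (- ln w) <= (1 - p) * (w^-1 - 1) by rewrite ler_wpM2l// subr_ge0.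
have h5 : p * (u / w - 1) + (1 - p) * (w^-1 - 1) = 0.
  transitivity ((1 - p + p * u) / w - 1); first by ring.
  have -> : 1 - p + p * u = w by rewrite /w; ring.
  by rewrite divff ?subrr// gt_eqF.
lra.
Qed.

(** Take the reciprocal of the previous bound at exponent 1 - p and use (1 - a)(1 + a) <= 1 with a =
    (1 - p)(u - 1). *)
Lemma powR_ge_tangent1 p u : 0 <= p <= 1 -> 0 < u -> 1 + (p - 1) * (u - 1) <= u `^ (p - 1).
Proof.
move=> /andP[p0 p1] u0.
have h : u `^ (1 - p) <= 1 + (1 - p) * (u - 1).
  by apply: powR_le_tangent1; rewrite // subr_ge0 p1 gerBl.
have -> : p - 1 = - (1 - p) by ring.
rewrite powRN.
have v0 := powR_gt0 (1 - p) u0; have w0 := lt_le_trans v0 h.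
apply: (@le_trans _ _ (1 + (1 - p) * (u - 1))^-1); last by rewrite lef_pV2.
rewrite -[leRHS]div1r ler_pdivlMr//.
have := sqr_ge0 ((1 - p) * (u - 1)); nra.
Qed.

Lemma powRB1 z p : 0 < z -> z `^ (p - 1) = z `^ p / z.
Proof.
move=> z0; rewrite powRD; first by rewrite powRN powRr1// ltW.
by rewrite (gt_eqF z0) implybT.
Qed.

Lemma powR_le_tangent p y z : 0 <= p <= 1 -> 0 < y -> 0 < z ->
  y `^ p <= z `^ p + p * z `^ (p - 1) * (y - z).
Proof.
move=> p01 y0 z0.
have := powR_le_tangent1 p01 (divr_gt0 y0 z0).
have -> : y `^ p = z `^ p * (y / z) `^ p.
  by rewrite -powRM ?ltW ?divr_gt0// mulrC divfK ?gt_eqF.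
rewrite -(@ler_pM2l _ (z `^ p)) ?powR_gt0//; move/le_trans; apply.
by rewrite powRB1// le_eqVlt; apply/orP; left; apply/eqP; field; rewrite gt_eqF.
Qed.

Lemma powR_ge_tangent p y z : 0 <= p <= 1 -> 0 < y -> 0 < z ->
  z `^ (p - 1) + (p - 1) * (z `^ (p - 1) / z) * (y - z) <= y `^ (p - 1).
Proof.
move=> p01 y0 z0.
have := powR_ge_tangent1 p01 (divr_gt0 y0 z0).
have -> : y `^ (p - 1) = z `^ (p - 1) * (y / z) `^ (p - 1).
  by rewrite -powRM ?ltW ?divr_gt0// mulrC divfK ?gt_eqF.
rewrite -(@ler_pM2l _ (z `^ (p - 1))) ?powR_gt0//; apply: le_trans.
by rewrite le_eqVlt; apply/orP; left; apply/eqP; field; rewrite gt_eqF.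
Qed.

Lemma exp_growth1 : exp_growth (fun=> 1 : R).
Proof. by apply: (@exp_growth_le _ _ 1) => n; rewrite normr1 mul1r ler1n. Qed.

Lemma exp_growth_id : exp_growth (fun n => n%:R : R).
Proof. by apply: (@exp_growth_le _ _ 1) => n; rewrite mul1r ger0_norm// ler_nat. Qed.

Lemma exp_growthZ (a : nat -> R) (k : R) : exp_growth a -> exp_growth (fun n => k * a n).
Proof.
by move=> [C aC]; exists (`|k| * C) => n; rewrite normrM -mulrA ler_wpM2l.
Qed.

Lemma poisson_mean_id x : poisson_mean (fun n => n%:R) x = x.
Proof.
have := poisson_mean_pred x exp_growth1.
by rewrite poisson_mean1 mulr1 => {2}<-; congr (poisson_mean _ _); apply/funext => n; rewrite mulr1.
Qed.

Lemma affine_growth (u v : R) : exp_growth (fun n => u * 1 + v * n%:R).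
Proof. by apply: exp_growthD; [exact/exp_growthZ/exp_growth1|exact: exp_growth_id]. Qed.

Lemma poisson_mean_affine (u v : R) x : poisson_mean (fun n => u * 1 + v * n%:R) x = u + v * x.
Proof.
have g1 := exp_growth1; have gid := exp_growth_id; have gu := exp_growthZ u g1.
by rewrite poisson_meanD// poisson_meanZ// poisson_mean_id poisson_mean1 mulr1.
Qed.

(* Jensen's inequality for the convex function [y |-> y `^ (L - 1)]: if [n] is
   Poisson of mean [x], then [n + 1] has mean [x + 1]. *)
Lemma poisson_mean_rising_ge L g x : 0 <= L <= 1 -> 0 <= x ->
  (forall n, n.+1%:R `^ (L - 1) <= g * rising L n) ->
  (x + 1) `^ (L - 1) <= g * poisson_mean (rising L) x.
Proof.
move=> L01 x0 gL; have x10 : 0 < x + 1 by rewrite ltr_wpDl.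
pose v := (L - 1) * ((x + 1) `^ (L - 1) / (x + 1)).
rewrite -poisson_meanZ; last exact: rising_growth.
have -> : (x + 1) `^ (L - 1) = poisson_mean (fun n => ((x + 1) `^ (L - 1) - v * x) * 1 + v * n%:R) x.
  by rewrite poisson_mean_affine subrK.
apply: poisson_mean_le => //; first exact: affine_growth.
  exact/exp_growthZ/rising_growth.
move=> n; apply: le_trans (gL n).
have := powR_ge_tangent L01 (ltr0Sn R n) x10; apply: le_trans.
by rewrite le_eqVlt; apply/orP; left; apply/eqP; rewrite /v; ring.
Qed.

(** The hypothesis bounds m [rising L m] for m >= 1 by a concave power. By the Stein-Chen identity
    this controls the mean of the shifted sequence; undoing the shift costs (1 - L) times the mean
    of [rising L n] / (n + 1), which is at most 1 / x. *)
Lemma poisson_mean_rising_le L g x : 0 <= L <= 1 -> 0 < x -> 0 <= g ->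
  (forall n, g * (n.+1%:R * rising L n.+1) <= n.+1%:R `^ L) ->
  g * poisson_mean (rising L) x <= x `^ (L - 1) + g / x.
Proof.
move=> L01 x0 g0 gL; have [L0 L1] := andP L01.
pose f n := rising L n / n.+1%:R.
have gf : exp_growth f.
  apply: (@exp_growth_le _ _ 1) => n; rewrite ger0_norm; last first.
    by rewrite divr_ge0// rising_ge0.
  rewrite mul1r ler_pdivrMr// (le_trans (rising_le1 _ L01))// -natrM ler1n.
  by rewrite muln_gt0.
have h1 : poisson_mean f x <= x^-1.
  rewrite -(@ler_pM2l _ x)// divff ?gt_eqF//.
  rewrite -poisson_mean_pred// -[leRHS](poisson_mean1 x).
  apply: poisson_mean_le; [exact: ltW| |exact: exp_growth1|].
    apply: (@exp_growth_le _ _ 1) => -[|n]; first by rewrite mul0r normr0.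
    rewrite /f/= mulrC divfK// ger0_norm ?rising_ge0// mul1r.
    by rewrite (le_trans (rising_le1 _ L01))// ler1n.
  move=> [|n]; first by rewrite mul0r.
  by rewrite /f/= mulrC divfK// rising_le1.
have h2 : g * poisson_mean (fun n => rising L n.+1) x <= x `^ (L - 1).
  rewrite (_ : (fun n => _) = (fun n => L * rising_tail L n)); last first.
    by apply/funext => n; rewrite risingS.
  have gt := rising_tail_growth L01.
  rewrite poisson_meanZ// powRB1// ler_pdivlMr//.
  have -> : g * (L * poisson_mean (rising_tail L) x) * x =
      g * L * (x * poisson_mean (rising_tail L) x) by ring.
  have ge := rising_sum_growth L01.
  rewrite -poisson_mean_pred// -poisson_meanZ//.
  pose v := L * x `^ (L - 1).
  have -> : x `^ L = poisson_mean (fun n => (x `^ L - v * x) * 1 + v * n%:R) x.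
    by rewrite poisson_mean_affine subrK.
  apply: poisson_mean_le; [exact: ltW|exact: exp_growthZ|exact: affine_growth|].
  (* Index 0 is not covered by [gL]: there the tangent of t^L at x takes the value (1 - L) x^L >=
     0. *)
  move=> [|n].
    rewrite mul0r !mulr0 addr0 mulr1 /v powRB1// mulrA divfK ?gt_eqF//.
    by rewrite -{1}[x `^ L]mul1r -mulrBl mulr_ge0 ?powR_ge0// subr_ge0.
  have := gL n; rewrite risingS/= => h; apply: (@le_trans _ _ (n.+1%:R `^ L)).
    by apply: le_trans h; rewrite le_eqVlt; apply/orP; left; apply/eqP; ring.
  apply: le_trans (powR_le_tangent L01 (ltr0Sn R n) x0) _.
  by rewrite le_eqVlt; apply/orP; left; apply/eqP; rewrite /v; ring.
have -> : poisson_mean (rising L) x =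
    poisson_mean (fun n => rising L n.+1) x + (1 - L) * poisson_mean f x.
  rewrite -poisson_meanD//; last exact/exp_growth_shift/rising_growth.
  congr (poisson_mean _ _); apply/funext => n.
  rewrite /f {2}/rising big_ord_recr/= -/(rising L n).
  by field; rewrite nat1r pnatr_eq0.
rewrite mulrDr lerD// ler_wpM2l//; apply: le_trans h1.
rewrite ler_piMl ?gerBl// (le_trans _ (poisson_mean_le (ltW x0) (exp_growthZ 0 exp_growth1) gf _))//.
  by rewrite poisson_meanZ ?mul0r//; exact: exp_growth1.
by move=> n; rewrite mul0r divr_ge0// rising_ge0.
Qed.

Lemma powRN_cvg0 L : 0 < L -> x `^ (- L) @[x --> +oo] --> (0 : R).
Proof.
move=> L0; apply/cvgrPdist_le => /= e e0; near=> x.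
have x0 : 0 < x by near: x; apply: nbhs_pinfty_gt.
rewrite sub0r normrN ger0_norm ?powR_ge0// powRN -[leRHS]invrK lef_pV2 ?posrE ?invr_gt0 ?powR_gt0//.
have : (e^-1) `^ (L^-1) <= x by near: x; apply: nbhs_pinfty_ge.
move=> /(ge0_ler_powR (ltW L0)); rewrite -powRrM mulVf ?gt_eqF// powRr1 ?invr_ge0 ?(ltW e0)//.
by apply; rewrite nnegrE ?powR_ge0// ltW.
Unshelve. all: by end_near. Qed.

(** Here g will be Gamma(L). In the lower bound (x / (x + 1))^(1 - L) is replaced by the smaller x /
    (x + 1) = 1 - 1 / (x + 1). *)
Lemma poisson_mean_rising_cvg L g : 0 < L < 1 -> 0 < g ->
  (forall n, n.+1%:R `^ (L - 1) <= g * rising L n) ->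
  (forall n, g * (n.+1%:R * rising L n.+1) <= n.+1%:R `^ L) ->
  x `^ (1 - L) * poisson_mean (rising L) x @[x --> +oo] --> g^-1.
Proof.
move=> /andP[L0 L1] g0 gL1 gL2.
have L01 : 0 <= L <= 1 by rewrite !ltW.
apply: (@squeeze_cvgr _ _ _ _ (fun x => g^-1 * (1 - (x + 1)^-1)) (fun x => g^-1 + x `^ (- L))).
- near=> x.
  have x0 : 0 < x by near: x; apply: nbhs_pinfty_gt.
  have xp : 0 < x `^ (1 - L) by apply: powR_gt0.
  have := poisson_mean_rising_ge L01 (ltW x0) gL1.
  have := poisson_mean_rising_le L01 x0 (ltW g0) gL2.
  have xg0 : 0 < x `^ (1 - L) / g by rewrite divr_gt0.
  rewrite -[X in is_true X -> _](ler_pM2l xg0) -[X in _ -> is_true X -> _](ler_pM2l xg0).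
  have -> : x `^ (1 - L) / g * (g * poisson_mean (rising L) x) =
     x `^ (1 - L) * poisson_mean (rising L) x by field; rewrite gt_eqF.
  have xx : x `^ (1 - L) * x `^ (L - 1) = 1.
    by rewrite -powRD ?(gt_eqF x0) ?implybT// (_ : 1 - L + (L - 1) = 0) ?powRr0//; ring.
  move=> h2 h1; apply/andP; split.
    apply: le_trans h1.
    rewrite [X in _ <= X * _]mulrC -mulrA ler_wpM2l ?invr_ge0 ?(ltW g0)//.
    have x10 : 0 < x + 1 by rewrite ltr_wpDl// ltW.
    have -> : L - 1 = - (1 - L) by ring.
    have -> : (x + 1) `^ (- (1 - L)) = (x + 1)^-1 `^ (1 - L).
      by rewrite -[in RHS]powR_inv1 ?(ltW x10)// -powRrM mulN1r.
    rewrite -powRM ?(ltW x0) ?invr_ge0 ?(ltW x10)//.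
    have -> : 1 - (x + 1)^-1 = x / (x + 1) by field; rewrite gt_eqF.
    apply: ger1_powR; last by rewrite gerBl ltW.
    by rewrite divr_gt0//= ler_pdivrMr// mul1r lerDl.
  apply: le_trans h2 _; rewrite mulrDr [X in X + _]mulrAC xx mul1r lerD2l.
  rewrite (_ : x `^ (- L) = x `^ (1 - L) / x); last first.
    by rewrite -powRB1//; congr (_ `^ _); ring.
  by rewrite mulrA divfK ?gt_eqF.
- rewrite -[X in _ --> X]mulr1; apply: cvgM; first exact: cvg_cst.
  rewrite -[X in _ --> X]subr0; apply: cvgB; first exact: cvg_cst.
  apply/cvgrPdist_le => /= e e0; near=> x.
  have x0 : 0 < x + 1 by rewrite ltr_wpDl//; near: x; apply: nbhs_pinfty_ge.
  rewrite sub0r normrN ger0_norm ?invr_ge0 ?(ltW x0)// -[leRHS]invrK lef_pV2 ?posrE ?invr_gt0//.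
  by rewrite (@le_trans _ _ x) ?lerDl//; near: x; apply: nbhs_pinfty_ge.
- rewrite -[X in _ --> X]addr0; apply: cvgD; first exact: cvg_cst.
  exact: powRN_cvg0.
Unshelve. all: by end_near. Qed.

End Tangent.

(** * The Gamma integral, its bounds, and the decay of the explicit solution *)

Section GammaTheory.
Context {R : realType}.
Implicit Types (p x t L : R).
Notation mu := (@lebesgue_measure R).

Definition gamma_integrand p t : R := t `^ (p - 1) * expR (- t).

(** Extended-real values let the functional equation and the integral comparisons be proved before
    finiteness; finiteness is then one of their consequences. *)
Definition egamma p : \bar R := (\int[mu]_(t in `]0%R, +oo[) (gamma_integrand p t)%:E)%E.

Lemma gamma_integrand_ge0 p t : 0 <= gamma_integrand p t.
Proof. by rewrite mulr_ge0 ?powR_ge0 ?expR_ge0. Qed.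

Lemma measurable_gamma_integrand p (D : set R) : measurable D ->
  measurable_fun D (gamma_integrand p).
Proof.
move=> mD; apply: measurable_funM.
  by apply: (@measurable_funTS); exact: measurable_powR.
apply: measurable_funTS; apply: measurableT_comp => //.
Qed.

(** Compact intervals that avoid 0, where t^(p - 1) may be singular. Starting at 2 keeps them
    nondegenerate already for n = 0. *)
Let exhaust n : set R := `[n.+2%:R^-1, n.+2%:R].

Let exhaust_measurable n : measurable (exhaust n).
Proof. exact: measurable_itv. Qed.

Let exhaust_mono : {homo exhaust : n m / (n <= m)%N >-> (n <= m)%O}.
Proof.
move=> n m nm; rewrite /exhaust subsetEset => t/=; rewrite !in_itv/= => /andP[h1 h2].
apply/andP; split.
  by apply: le_trans h1; rewrite lef_pV2 ?posrE// ler_nat.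
by apply: le_trans h2 _; rewrite ler_nat.
Qed.

Let exhaustT : \bigcup_n exhaust n = `]0, +oo[%classic.
Proof.
rewrite /exhaust; apply/seteqP; split => [t [n _]|t]/=; rewrite !in_itv/= ?andbT.
  by move=> /andP[h _]; apply: lt_le_trans h; rewrite invr_gt0.
move=> t0; pose n := (Num.bound t + Num.bound t^-1)%N.
exists n => //=; rewrite in_itv/=; apply/andP; split.
  rewrite -[leRHS]invrK lef_pV2 ?posrE ?invr_gt0//.
  apply: (@le_trans _ _ (Num.bound t^-1)%:R).
    by apply/ltW/archi_boundP; rewrite invr_ge0 ltW.
  by rewrite ler_nat; exact: (leq_trans (leq_addl _ _) (leq_trans (leqnSn n) (leqnSn _))).
apply: (@le_trans _ _ (Num.bound t)%:R).
  exact/ltW/archi_boundP/ltW.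
by rewrite ler_nat; exact: (leq_trans (leq_addr _ _) (leq_trans (leqnSn n) (leqnSn _))).
Qed.

Let egamma_cvg p :
  (\int[mu]_(t in exhaust n) (gamma_integrand p t)%:E @[n --> \oo] --> egamma p)%E.
Proof.
rewrite /egamma -exhaustT; apply: ge0_nondecreasing_set_cvg_integral => //.
- by move=> n; apply/measurable_EFinP; exact: measurable_gamma_integrand.
- by move=> n t _; rewrite lee_fin gamma_integrand_ge0.
Qed.

Lemma powR_expRN_cvg0 p : 0 < p -> t `^ p * expR (- t) @[t --> +oo] --> (0 : R).
Proof.
(* C is (2p)^p: the inequality ln s <= s at s = t / (2p) gives t^p <= C exp(t / 2). *)
move=> p0; pose C := expR (p * ln (2 * p)).
have p20 : 0 < 2 * p by rewrite mulr_gt0.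
apply: (@squeeze_cvgr _ _ _ _ (cst 0) (fun t => C * expR (- (t / 2)))).
- near=> t; have t0 : 0 < t by near: t; apply: nbhs_pinfty_gt.
  rewrite mulr_ge0 ?powR_ge0 ?expR_ge0//= /C -expRD /powR gt_eqF// -expRD ler_expR.
  have : ln (t / (2 * p)) <= t / (2 * p).
    by rewrite ltW// ln_sublinear// divr_gt0.
  rewrite ln_div ?posrE// => h.
  have : p * (ln t - ln (2 * p)) <= p * (t / (2 * p)) by rewrite ler_pM2l.
  have -> : p * (t / (2 * p)) = t / 2 by field; rewrite gt_eqF.
  lra.
- exact: cvg_cst.
- rewrite -[X in _ --> X](mulr0 C); apply: cvgM; first exact: cvg_cst.
  apply: (@cvg_comp _ _ _ (fun t => t / 2) (fun t => expR (- t)) _ +oo); last exact: cvgr_expR.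
  by apply: gt0_cvgMly.
Unshelve. all: by end_near. Qed.

Let boundary_cvg0 p : 0 < p ->
  n.+2%:R `^ p * expR (- n.+2%:R) - (n.+2%:R^-1) `^ p * expR (- n.+2%:R^-1) @[n --> \oo] --> (0 : R).
Proof.
move=> p0; rewrite -[X in _ --> X]subr0; apply: cvgB.
  apply: (@cvg_comp _ _ _ (fun n => n.+2%:R) (fun t => t `^ p * expR (- t)) _ +oo).
    by apply/cvgryPge => A; near=> n; apply: (@le_trans _ _ n%:R); rewrite ?ler_nat ?leqW//; near: n; exact: nbhs_infty_ger.
  exact: powR_expRN_cvg0.
apply: (@squeeze_cvgr _ _ _ _ (cst 0) (fun n => (n.+2%:R^-1 : R) `^ p)).
- near=> n; rewrite mulr_ge0 ?powR_ge0 ?expR_ge0//= ler_piMr ?powR_ge0//.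
- exact: cvg_cst.
- apply: (@cvg_comp _ _ _ (fun n => n.+2%:R^-1) (fun t : R => t `^ p) _ 0^'+); last exact: powR_cvg0.
  have h : (n.+2%:R^-1 : R) @[n --> \oo] --> (0 : R).
    by have := @cvg_harmonic R; rewrite -cvg_shiftS.
  move=> A hA.
  have {}h : \forall n \near \oo, (0 < (n.+2%:R^-1 : R) -> A n.+2%:R^-1) := h _ hA.
  apply: filterS h => n; apply => /=.
  by rewrite invr_gt0 ltr0n.
Unshelve. all: by end_near. Qed.

(** The fundamental theorem of calculus for t^p exp(-t), in additive form so that the limit can be
    taken in the extended reals. *)
Let exhaust_by_parts p n :
  (p%:E * \int[mu]_(t in exhaust n) (gamma_integrand p t)%:E
  = \int[mu]_(t in exhaust n) (gamma_integrand (p + 1) t)%:E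
   + (n.+2%:R `^ p * expR (- n.+2%:R) - (n.+2%:R^-1) `^ p * expR (- n.+2%:R^-1))%:E)%E.
Proof.
have ab : n.+2%:R^-1 < n.+2%:R :> R.
  apply: (@lt_le_trans _ _ 1); last by rewrite ler1n.
  by rewrite invf_lt1// ltr1n.
pose F t : R := t `^ p * expR (- t).
have tpos (t : R) : n.+2%:R^-1 <= t -> 0 < t.
  by apply: lt_le_trans; rewrite invr_gt0.
have dexp (t : R) : is_derive t 1 (fun t => expR (- t)) (- expR (- t)).
  by have := @is_derive_expR_scale R (-1) t; rewrite !mulN1r; under eq_fun do rewrite mulN1r.
have dF q (t : R) : 0 < t -> is_derive t 1 (fun t => t `^ q * expR (- t))
    (q * gamma_integrand q t - gamma_integrand (q + 1) t).
  move=> t0; apply: (is_derive_eq (is_deriveM (is_derive1_powR q t0) (dexp t))).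
  by rewrite /gamma_integrand /GRing.scale/= addrK; ring.
have cw q : {within exhaust n, continuous (gamma_integrand q)}.
  apply: continuous_in_subspaceT => t.
  rewrite inE /exhaust/= in_itv/= => /andP[/tpos t0 _].
  exact: is_derive_continuous (dF _ t t0).
have ci q : mu.-integrable (exhaust n) (EFin \o (gamma_integrand q)).
  by apply: continuous_compact_integrable => //; exact: segment_compact.
have H := @continuous_FTC2 _ (fun t => p * gamma_integrand p t - gamma_integrand (p + 1) t) F _ _ ab.
rewrite EFinB -[X in (_ + X)%E]H.
- under [X in (_ + X)%E]eq_integral do rewrite EFinB EFinM.
  rewrite integralB//; try exact: ci; try exact: ci; last first.
    by apply: integrableZl => //; exact: ci.
  rewrite integralZl//; last exact: ci.
  rewrite addeC subeK//.
  by apply: integrable_fin_num => //; exact: ci.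
- move=> t; apply: cvgB; last exact: cw.
  apply: cvgM; [exact: cvg_cst|exact: cw].
- split.
  + by move=> t; rewrite in_itv/= => /andP[/ltW/tpos t0 _]; have [] := dF p t t0.
  + apply: cvg_at_right_filter; apply: is_derive_continuous (dF p _ _).
    exact: tpos.
  + apply: cvg_at_left_filter; apply: is_derive_continuous (dF p _ _).
    by [].
- by move=> t; rewrite in_itv/= => /andP[/ltW/tpos t0 _]; rewrite derive1E; have [_ ->] := dF p t t0.
Qed.

Lemma egammaS p : 0 < p -> egamma (p + 1) = (p%:E * egamma p)%E.
Proof.
move=> p0; have h1 := @egamma_cvg (p + 1).
have h2 : (EFin \o (fun n => n.+2%:R `^ p * expR (- n.+2%:R) -
    (n.+2%:R^-1) `^ p * expR (- n.+2%:R^-1))) n @[n --> \oo] --> 0%:E.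
  by apply: cvg_EFin (boundary_cvg0 p0); exact: nearW.
have h3 : (p%:E * \int[mu]_(t in exhaust n) (gamma_integrand p t)%:E @[n --> \oo]
   --> p%:E * egamma p)%E.
  by apply: cvgeZl => //; exact: egamma_cvg.
have h4 : (p%:E * \int[mu]_(t in exhaust n) (gamma_integrand p t)%:E @[n --> \oo]
   --> egamma (p + 1) + 0)%E.
  under eq_fun do rewrite exhaust_by_parts.
  by apply: cvgeD => //; rewrite fin_num_adde_defl.
rewrite adde0 in h4.
by apply: cvg_unique h4 h3.
Unshelve. all: by end_near. Qed.

Lemma egamma1 : egamma 1 = 1%E.
Proof.
have -> : egamma 1 = (\int[mu]_(t in `]0%R, +oo[) (expR (- t))%:E)%E.
  apply: eq_integral => t _; rewrite /gamma_integrand subrr powRr0 mul1r//.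
rewrite integral_itv_obnd_cbnd; last first.
  by apply/measurable_EFinP; apply: measurable_funTS; apply: measurableT_comp.
have dexp (t : R) : is_derive t 1 (fun t => expR (- t)) (- expR (- t)).
  by have := @is_derive_expR_scale R (-1) t; rewrite !mulN1r; under eq_fun do rewrite mulN1r.
have dF (t : R) : is_derive t 1 (fun t => - expR (- t)) (expR (- t)).
  by apply: (is_derive_eq (is_deriveN (dexp t))); rewrite opprK.
rewrite (@ge0_continuous_FTC2y _ _ (fun t => - expR (- t)) _ 0).
- by rewrite oppr0 expR0 -EFinB opprK add0r.
- by move=> *; exact: expR_ge0.
- apply: continuous_subspaceT => t; exact: is_derive_continuous (dexp t).
- by rewrite -[X in _ --> X]oppr0; apply: cvgN; exact: cvgr_expR.
- by move=> t _; have [] := dF t.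
- by apply: cvg_at_right_filter; exact: is_derive_continuous (dF _).
- by move=> t _; rewrite derive1E; have [_ ->] := dF t.
Qed.

Lemma fine_egamma p : fine (egamma p) = Gamma p.
Proof. by []. Qed.

Lemma egamma_fact n : egamma n.+1%:R = n`!%:R%:E.
Proof.
elim: n => [|n IH]; first by rewrite egamma1 fact0.
by rewrite -natr1 egammaS// IH -EFinM -natrM -factS.
Qed.

Lemma ge0_egamma_lincomb p q (u v : R) : 0 <= u -> 0 <= v ->
  (\int[mu]_(t in `]0%R, +oo[) (u * gamma_integrand p t + v * gamma_integrand q t)%:E
  = u%:E * egamma p + v%:E * egamma q)%E.
Proof.
move=> u0 v0; under eq_integral do rewrite EFinD !EFinM.
rewrite ge0_integralD//.
- rewrite !ge0_integralZl//.
  + apply/measurable_EFinP; exact: measurable_gamma_integrand.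
  + by move=> *; rewrite lee_fin gamma_integrand_ge0.
  + apply/measurable_EFinP; exact: measurable_gamma_integrand.
  + by move=> *; rewrite lee_fin gamma_integrand_ge0.
- by move=> *; rewrite -EFinM lee_fin mulr_ge0// gamma_integrand_ge0.
- apply/measurable_EFinP; apply: measurable_funM => //; exact: measurable_gamma_integrand.
- by move=> *; rewrite -EFinM lee_fin mulr_ge0// gamma_integrand_ge0.
- apply/measurable_EFinP; apply: measurable_funM => //; exact: measurable_gamma_integrand.
Qed.

Lemma ge0_egammaZ p (u : R) : 0 <= u ->
  (\int[mu]_(t in `]0%R, +oo[) (u * gamma_integrand p t)%:E = u%:E * egamma p)%E.
Proof.
move=> u0; have := ge0_egamma_lincomb p p u0 (lexx 0); rewrite mul0e adde0 => <-.
by apply: eq_integral => t _; rewrite mul0r addr0.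
Qed.

Lemma gamma_integrandD p r t : 0 < t -> gamma_integrand (p + r) t = t `^ r * gamma_integrand p t.
Proof.
move=> t0; rewrite /gamma_integrand addrAC (@powRD _ t (p - 1) r); first ring.
by rewrite (gt_eqF t0) implybT.
Qed.

Lemma egamma_ge0 p : (0 <= egamma p)%E.
Proof. by apply: integral_ge0 => t _; rewrite lee_fin gamma_integrand_ge0. Qed.

(** Jensen for the concave t^L under the density t^n exp(-t) / n!, whose mean is z = n + 1: the
    linear term of the tangent at z integrates to zero. *)
Lemma egamma_le_tangent L n : 0 <= L <= 1 ->
  (egamma (n.+1%:R + L) <= (n.+1%:R `^ L * n`!%:R)%:E)%E.
Proof.
move=> L01; have [L0 L1] := andP L01.
set z : R := n.+1%:R; have z0 : 0 < z by rewrite ltr0n.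
apply: (@le_trans _ _ (((1 - L) * z `^ L)%:E * egamma z + (L * z `^ (L - 1))%:E * egamma (z + 1))%E).
  rewrite -ge0_egamma_lincomb; last 2 first.
    by rewrite mulr_ge0 ?powR_ge0// subr_ge0.
    by rewrite mulr_ge0 ?powR_ge0.
  apply: ge0_le_integral => //.
  - by move=> t _; rewrite lee_fin gamma_integrand_ge0.
  - by apply/measurable_EFinP; exact: measurable_gamma_integrand.
  - by apply/measurable_EFinP; apply: measurable_funD;
      apply: measurable_funM => //; exact: measurable_gamma_integrand.
  - move=> t/=; rewrite in_itv/= andbT => t0; rewrite lee_fin !gamma_integrandD// powRr1 ?(ltW t0)//.
    rewrite mulrA -mulrDl ler_wpM2r ?gamma_integrand_ge0//.
    apply: le_trans (powR_le_tangent L01 t0 z0) _.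
    rewrite le_eqVlt powRB1//; apply/orP; left; apply/eqP; field; rewrite gt_eqF//.
rewrite egammaS// egamma_fact -!EFinM -EFinD lee_fin powRB1//.
rewrite le_eqVlt; apply/orP; left; apply/eqP; field; rewrite gt_eqF//.
Qed.

(** The same with the convex t^(L - 1). Its tangent at z = n + 1 has nonpositive slope, so that term
    is moved to the other side and only nonnegative functions are integrated. *)
Lemma egamma_ge_tangent L n : 0 < L <= 1 ->
  ((n.+1%:R `^ (L - 1) * n`!%:R)%:E <= egamma (n%:R + L))%E.
Proof.
move=> /andP[L0 L1]; have L01 : 0 <= L <= 1 by rewrite L1 ltW.
set z : R := n.+1%:R; have z0 : 0 < z by rewrite ltr0n.
have gfin : egamma (z + 1) = n.+1`!%:R%:E by rewrite /z natr1 egamma_fact.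
have v0 : 0 <= (1 - L) * (z `^ (L - 1) / z) by rewrite mulr_ge0 ?divr_ge0 ?powR_ge0 ?subr_ge0.
have u0 : 0 <= (2 - L) * z `^ (L - 1).
  by rewrite mulr_ge0 ?powR_ge0// subr_ge0 (le_trans L1)// ler1n.
have : (((2 - L) * z `^ (L - 1))%:E * egamma z <=
    1%:E * egamma (n%:R + L) + ((1 - L) * (z `^ (L - 1) / z))%:E * egamma (z + 1))%E.
  rewrite -ge0_egamma_lincomb// -ge0_egammaZ//.
  apply: ge0_le_integral => //.
  - by move=> t _; rewrite lee_fin mulr_ge0// gamma_integrand_ge0.
  - by apply/measurable_EFinP; apply: measurable_funM => //; exact: measurable_gamma_integrand.
  - by apply/measurable_EFinP; apply: measurable_funD;
      apply: measurable_funM => //; exact: measurable_gamma_integrand.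
  - move=> t/=; rewrite in_itv/= andbT => t0; rewrite lee_fin mul1r.
    have -> : n%:R + L = z + (L - 1) by rewrite /z -natr1; ring.
    rewrite !gamma_integrandD// powRr1 ?(ltW t0)// mulrA -mulrDl ler_wpM2r ?gamma_integrand_ge0//.
    have := powR_ge_tangent L01 t0 z0; rewrite -lerBlDr; apply: le_trans.
    by rewrite le_eqVlt; apply/orP; left; apply/eqP; field; rewrite gt_eqF.
rewrite gfin {1}/z egamma_fact mul1e -leeBlDr// -!EFinM -EFinB; apply: le_trans.
rewrite lee_fin factS natrM -/z le_eqVlt; apply/orP; left; apply/eqP; field; rewrite gt_eqF//.
Qed.

(** L [egamma L] = [egamma (L + 1)], and the latter is at most 1 by the tangent bound at n = 0. *)
Lemma egamma_fin L : 0 < L <= 1 -> egamma L \is a fin_num.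
Proof.
move=> /andP[L0 L1]; have L01 : 0 <= L <= 1 by rewrite L1 ltW.
have := egamma_le_tangent 0 L01; rewrite addrC egammaS// => h.
have : (L%:E * egamma L < +oo)%E by apply: le_lt_trans h _; rewrite ltry.
move: (egamma_ge0 L); case: (egamma L) => //= _.
by rewrite mulry gtr0_sg// mul1e.
Qed.

Lemma egamma_rising L n : 0 < L <= 1 ->
  egamma (n%:R + L) = (fine (egamma L) * (rising L n * n`!%:R))%:E.
Proof.
move=> L01; have [L0 L1] := andP L01; elim: n => [|n IH].
  by rewrite add0r /rising big_ord0 fact0 !mulr1 fineK// egamma_fin.
rewrite -nat1r -addrA addrC egammaS ?IH ?ltr_wpDl// -EFinM; congr EFin.
rewrite /rising big_ord_recr/= -/(rising L n) factS natrM; field.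
by rewrite nat1r pnatr_eq0.
Qed.

Lemma Gamma_gt0 L : 0 < L <= 1 -> 0 < Gamma L.
Proof.
move=> L01; have := egamma_ge_tangent 0 L01.
rewrite -fine_egamma add0r powR1 fact0 mulr1 -(fineK (egamma_fin L01)) lee_fin; apply: lt_le_trans => //.
Qed.

Lemma Gamma_rising_ge L n : 0 < L <= 1 -> n.+1%:R `^ (L - 1) <= Gamma L * rising L n.
Proof.
move=> L01; have := egamma_ge_tangent n L01.
by rewrite egamma_rising// fine_egamma lee_fin mulrA ler_pM2r// ltr0n fact_gt0.
Qed.

Lemma Gamma_rising_le L n : 0 < L <= 1 ->
  Gamma L * (n.+1%:R * rising L n.+1) <= n.+1%:R `^ L.
Proof.
move=> L01; have [L0 L1] := andP L01.
have := @egamma_le_tangent L n; rewrite L1 (ltW L0) => /(_ isT).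
rewrite egamma_rising// fine_egamma lee_fin factS natrM.
have -> : Gamma L * (rising L n.+1 * (n.+1%:R * n`!%:R)) =
  Gamma L * (n.+1%:R * rising L n.+1) * n`!%:R by ring.
by rewrite ler_pM2r// ltr0n fact_gt0.
Qed.

Lemma averaged_ode_sol_decay (l1 l2 a : R) : 0 < l1 -> 0 <= l2 < l1 ->
  t `^ (1 - l2 / l1) * averaged_ode_sol l1 l2 a t @[t --> +oo] -->
    l1 `^ (l2 / l1 - 1) * inv_Gamma (l2 / l1) * a.
Proof.
move=> l10 /andP[l20 l21]; rewrite /averaged_ode_sol; set L := l2 / l1.
have L0 : 0 <= L by rewrite divr_ge0// ltW.
have L1 : L < 1 by rewrite ltr_pdivrMr// mul1r.
have key : x `^ (1 - L) * poisson_mean (rising L) x @[x --> +oo] --> inv_Gamma L.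
  (* For L = 0 only the coefficient at n = 0 survives, the Poisson mean is exp(-x), and x exp(-x)
     tends to 0, in accordance with 1/Gamma(0) = 0. *)
  rewrite /inv_Gamma; have [L00|Ln0] := eqVneq L 0.
    rewrite L00 subr0; apply: cvg_trans (powR_expRN_cvg0 ltr01).
    apply: near_eq_cvg; near=> x; congr (_ * _).
    rewrite (_ : rising 0 = (fun n => (n == 0%N)%:R)).
      rewrite /poisson_mean (_ : limn _ = 1 :> R) ?mulr1//.
      apply: lim_near_cst => //; near=> m; rewrite -[m]prednK; last by near: m.
      by rewrite /pseries /series/= big_nat_recl//= big1 ?addr0 ?expr0 ?fact0 ?divr1 ?mulr1// => i _; rewrite !mul0r.
    by apply/funext => -[|n]; rewrite ?risingS ?mul0r// /rising big_ord0.
  have {}L0 : 0 < L by rewrite lt_neqAle eq_sym Ln0.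
  have L01 : 0 < L <= 1 by rewrite L0 ltW.
  apply: poisson_mean_rising_cvg; rewrite ?L0 ?L1 ?Gamma_gt0//.
  - by move=> n; exact: Gamma_rising_ge.
  - by move=> n; exact: Gamma_rising_le.
have key2 : (l1 * t) `^ (1 - L) * poisson_mean (rising L) (l1 * t) @[t --> +oo] --> inv_Gamma L.
  apply: (@cvg_comp _ _ _ (fun t => l1 * t) _ _ +oo _ _ key).
  apply/cvgryPge => A; near=> t; rewrite -ler_pdivrMl//; near: t; exact: nbhs_pinfty_ge.
have : (a * l1 `^ (L - 1)) * ((l1 * t) `^ (1 - L) * poisson_mean (rising L) (l1 * t)) @[t --> +oo] -->
    a * l1 `^ (L - 1) * inv_Gamma L.
  by apply: cvgM => //; exact: cvg_cst.
rewrite (_ : a * l1 `^ (L - 1) * inv_Gamma L = l1 `^ (L - 1) * inv_Gamma L * a); last by ring.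
apply: cvg_trans; apply: near_eq_cvg; near=> t.
have t0 : 0 < t by near: t; apply: nbhs_pinfty_gt.
rewrite /= powRM ?(ltW l10) ?(ltW t0)//.
have ll : l1 `^ (L - 1) * l1 `^ (1 - L) = 1.
  rewrite -powRD ?(gt_eqF l10) ?implybT// (_ : L - 1 + (1 - L) = 0) ?powRr0//; ring.
transitivity (l1 `^ (L - 1) * l1 `^ (1 - L) *
  (t `^ (1 - L) * (a * poisson_mean (rising L) (l1 * t)))); first by ring.
by rewrite ll mul1r.
Unshelve. all: by end_near. Qed.

End GammaTheory.

(** * Euclidean inner product and norm *)

Section EuclideanTheory.
Context {R : realType} {d : nat}.
Implicit Types (x y v : 'rV[R]_d).

Lemma dotvC x y : dotv x y = dotv y x.
Proof. by apply: eq_bigr => i _; rewrite mulrC. Qed.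

Lemma dotvDl x y v : dotv (x + y) v = dotv x v + dotv y v.
Proof. by rewrite -big_split/=; apply: eq_bigr => i _; rewrite mxE mulrDl. Qed.

Lemma dotvDr x y v : dotv v (x + y) = dotv v x + dotv v y.
Proof. by rewrite ![dotv v _]dotvC dotvDl. Qed.

Lemma dotvZl (a : R) x y : dotv (a *: x) y = a * dotv x y.
Proof. by rewrite mulr_sumr; apply: eq_bigr => i _; rewrite mxE mulrA. Qed.

Lemma dotvZr (a : R) x y : dotv x (a *: y) = a * dotv x y.
Proof. by rewrite dotvC dotvZl dotvC. Qed.

Lemma dotvNl x y : dotv (- x) y = - dotv x y.
Proof. by rewrite -scaleN1r dotvZl mulN1r. Qed.

Lemma dotvNr x y : dotv x (- y) = - dotv x y.
Proof. by rewrite dotvC dotvNl dotvC. Qed.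

Lemma dotv_ge0 x : 0 <= dotv x x.
Proof. by apply: sumr_ge0 => i _; rewrite -expr2 sqr_ge0. Qed.

Lemma enorm_ge0 x : 0 <= enorm x.
Proof. exact: sqrtr_ge0. Qed.

Lemma sqr_enorm x : enorm x ^+ 2 = dotv x x.
Proof. by rewrite sqr_sqrtr ?dotv_ge0. Qed.

Lemma dotv_young x y (k : R) : 0 < k -> 2 * dotv x y <= dotv x x / k + k * dotv y y.
Proof.
move=> k0; have := dotv_ge0 (x - k *: y).
rewrite !(dotvDl, dotvDr, dotvNl, dotvNr, dotvZl, dotvZr) (dotvC y x) => h.
rewrite -(ler_pM2l k0) mulrDr [k * (_ / _)]mulrC divfK ?gt_eqF//.
rewrite -subr_ge0; apply: le_trans h _.
by rewrite le_eqVlt; apply/orP; left; apply/eqP; ring.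
Qed.

(** Young's inequality at the optimal k = |x| / |y|. If one norm vanishes, k is free, and a very
    large or very small k excludes a positive inner product. *)
Lemma dotv_le x y : dotv x y <= enorm x * enorm y.
Proof.
have [y0|yn0] := eqVneq (enorm y) 0.
  have h k : 0 < k -> 2 * dotv x y <= dotv x x / k.
    by move=> /(dotv_young x y); rewrite -[dotv y y]sqr_enorm y0 expr0n mulr0 addr0.
  rewrite y0 mulr0; rewrite leNgt; apply/negP => xy.
  have x0 : 0 < dotv x x + 1 by rewrite ltr_wpDl ?dotv_ge0.
  have := h ((dotv x x + 1) / dotv x y) (divr_gt0 x0 xy).
  rewrite invf_div mulrA ler_pdivlMr// => H.
  have := dotv_ge0 x; nra.
have y0 : 0 < enorm y by rewrite lt_neqAle eq_sym yn0 enorm_ge0.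
have [x0|xn0] := eqVneq (enorm x) 0.
  have h k : 0 < k -> 2 * dotv x y <= k * dotv y y.
    by move=> /(dotv_young x y); rewrite -[dotv x x]sqr_enorm x0 expr0n mul0r add0r.
  rewrite x0 mul0r; rewrite leNgt; apply/negP => xy.
  have yy0 : 0 < dotv y y by rewrite -sqr_enorm exprn_gt0.
  have := h (dotv x y / dotv y y) (divr_gt0 xy yy0); rewrite divfK ?gt_eqF//; lra.
have x0 : 0 < enorm x by rewrite lt_neqAle eq_sym xn0 enorm_ge0.
have := @dotv_young x y (enorm x / enorm y) (divr_gt0 x0 y0).
rewrite -!sqr_enorm => h; rewrite -(ler_pM2l (ltr0Sn R 1)); apply: le_trans h _.
rewrite le_eqVlt; apply/orP; left; apply/eqP; field.
by rewrite !gt_eqF.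
Qed.

Lemma sqr_dotv_le x y : dotv x y ^+ 2 <= dotv x x * dotv y y.
Proof.
rewrite -!sqr_enorm -exprMn -[leLHS]real_normK ?num_real//.
rewrite ler_sqr ?nnegrE ?mulr_ge0 ?enorm_ge0//.
rewrite ler_norml dotv_le andbT lerNl -dotvNl (le_trans (dotv_le _ _))//.
by rewrite /enorm dotvNl dotvNr opprK.
Qed.

Lemma enormN x : enorm (- x) = enorm x.
Proof. by rewrite /enorm dotvNl dotvNr opprK. Qed.

Lemma ler_enormD x y : enorm (x + y) <= enorm x + enorm y.
Proof.
rewrite -ler_sqr ?nnegrE ?addr_ge0 ?enorm_ge0//.
rewrite sqr_enorm !(dotvDl, dotvDr) (dotvC y x) sqrrD !sqr_enorm.
have := dotv_le x y; lra.
Qed.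

Lemma ler_coord_enorm x i : `|x 0 i| <= enorm x.
Proof.
rewrite -[leLHS]sqrtr_sqr ler_wsqrtr// /dotv (bigD1 i)//= expr2 lerDl.
by apply: sumr_ge0 => j _; rewrite -expr2 sqr_ge0.
Qed.

Lemma sqr_enormD_le x y : enorm (x + y) ^+ 2 <= 2 * (enorm x ^+ 2 + enorm y ^+ 2).
Proof.
rewrite !sqr_enorm !(dotvDl, dotvDr) (dotvC y x).
have := dotv_young x y ltr01; lra.
Qed.

End EuclideanTheory.

(** * Vector-valued integrals and Jensen's inequality for the squared norm *)

Section VectorIntegral.
Context {R : realType} {d : nat} (disp : measure_display) (T : measurableType disp)
  (mu : {measure set T -> \bar R}).
Implicit Types (f : T -> 'rV[R]_d) (D : set T).

Definition integrable_rV D f := forall i, mu.-integrable D (EFin \o (fun s => f s 0 i)).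

Lemma integrable_dotv D f (u : 'rV[R]_d) : measurable D -> integrable_rV D f ->
  mu.-integrable D (EFin \o (fun s => dotv u (f s))).
Proof.
move=> mD fi; rewrite [X in mu.-integrable D X](_ : _ = (fun s => \sum_(i < d) (u 0 i)%:E * (f s 0 i)%:E)%E).
  by apply: integrable_sum => // i _; apply: integrableZl => //; exact: fi.
by apply/funext => s /=; rewrite /dotv -sumEFin; apply: eq_bigr => i _; rewrite EFinM.
Qed.

Lemma dotv_rVint D f (u : 'rV[R]_d) : measurable D -> integrable_rV D f ->
  dotv u (rVint mu D f) = \int[mu]_(s in D) dotv u (f s).
Proof.
move=> mD fi; rewrite /Rintegral.
under eq_integral => s _ do (rewrite /dotv -sumEFin; under eq_bigr => i _ do rewrite EFinM).
rewrite integral_sum//; last by move=> i; apply: integrableZl => //; exact: fi.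
rewrite -sum_fine; last first.
  by move=> i _; apply: integrable_fin_num => //; apply: integrableZl => //; exact: fi.
apply: eq_bigr => i _; rewrite mxE integralZl//; last exact: fi.
by rewrite fineM//; apply: integrable_fin_num => //; exact: fi.
Qed.

(* With [u] the integral, integrate [2 <u, f> <= |u|^2 / M + M |f|^2]. *)
Lemma sqr_enorm_rVint D f (g : T -> R) (M : R) : measurable D -> 0 < M ->
  mu D = M%:E -> integrable_rV D f -> mu.-integrable D (EFin \o g) ->
  (forall s, D s -> enorm (f s) ^+ 2 <= g s) ->
  enorm (rVint mu D f) ^+ 2 <= M * \int[mu]_(s in D) g s.
Proof.
move=> mD M0 muD fi gi fg; set u := rVint mu D f.
have ci (c : R) : mu.-integrable D (EFin \o cst c).
  by apply: measurable_bounded_integrable => //=; rewrite ?muD ?ltry//; exact: bounded_cst.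
rewrite sqr_enorm.
have : 2 * dotv u u <= dotv u u + M * \int[mu]_(s in D) g s.
  have h1 : 2 * dotv u u = \int[mu]_(s in D) (2 * dotv u (f s)).
    by rewrite RintegralZl -?dotv_rVint//; exact: integrable_dotv.
  have h2 : dotv u u = \int[mu]_(s in D) (dotv u u / M).
    by rewrite Rintegral_cst// muD/= divfK ?gt_eqF.
  rewrite h1 [X in _ <= X + _]h2 -RintegralZl//.
  have gZ : mu.-integrable D (EFin \o (fun s => M * g s)).
    by have := @integrableZl _ _ _ mu D mD M _ gi.
  rewrite -RintegralD//; try exact: ci.
  apply: le_Rintegral => //.
  - by apply: (@integrableZl _ _ _ _ _ _ _ (fun s => (dotv u (f s))%:E)) => //; exact: integrable_dotv.
  - exact: (integrableD mD (ci _) gZ).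
  - move=> s Ds; apply: le_trans (dotv_young u (f s) M0) _.
    by rewrite lerD2l ler_wpM2l ?(ltW M0)// -[dotv (f s) _]sqr_enorm fg.
lra.
Qed.

End VectorIntegral.

(** * Scalar Young inequalities with the constants of lambda1 and lambda2 *)

Section DriftInequality.
Context {R : realType}.

(** Completing squares in s and in p. The coefficient of m^2 is the sum 2/gamma + gamma / (2 (1 +
    gamma)) of the two remainders; this is the origin of (2 + gamma)^2 / (1 + gamma) in
    [lambda2]. *)
Lemma young_drift (gamma cB p s m : R) : 0 < gamma -> 0 <= cB ->
  cB * ((2 * p + 4 / gamma * s) * m) <=
  cB * ((2 + 2 / gamma) * p ^+ 2 + 2 / gamma * s ^+ 2)
  + cB * ((2 + gamma) ^+ 2 / (2 * gamma * (1 + gamma)) * m ^+ 2).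
Proof.
move=> g0 c0; rewrite -mulrDr ler_wpM2l// -subr_ge0.
have g1 : 0 < 1 + gamma by rewrite addr_gt0.
have -> : (2 + 2 / gamma) * p ^+ 2 + 2 / gamma * s ^+ 2 +
   (2 + gamma) ^+ 2 / (2 * gamma * (1 + gamma)) * m ^+ 2 - (2 * p + 4 / gamma * s) * m
 = 2 / gamma * (s - m) ^+ 2
  + (2 * (1 + gamma) / gamma) * (p - gamma / (2 * (1 + gamma)) * m) ^+ 2.
  by field; rewrite !gt_eqF.
by rewrite addr_ge0// mulr_ge0 ?sqr_ge0// divr_ge0 ?mulr_ge0 ?(ltW g0) ?(ltW g1).
Qed.

Lemma young_lipschitz (gamma c p s : R) : 0 < gamma -> 0 <= c ->
  (2 * p + 4 / gamma * s) * (c * p) <= c * ((2 + 2 / gamma) * p ^+ 2 + 2 / gamma * s ^+ 2).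
Proof.
move=> g0 c0; rewrite mulrCA ler_wpM2l// -subr_ge0.
have -> : (2 + 2 / gamma) * p ^+ 2 + 2 / gamma * s ^+ 2 - (2 * p + 4 / gamma * s) * p
   = 2 / gamma * (p - s) ^+ 2 by ring.
by rewrite mulr_ge0 ?sqr_ge0// divr_ge0 ?ltW.
Qed.

End DriftInequality.

(** * Primitives and time averages on the open half-line *)

Section Averages.
Context {R : realType}.
Implicit Types (f : R -> R) (t u : R).
Notation mu := (@lebesgue_measure R).

(** Time 0 is left out because time averages are handled for t > 0 only; boundedness near 0 and
    continuity on the open half-line suffice to differentiate a primitive. *)
Definition locally_bounded0 f := forall u, exists M, forall s, 0 < s <= u -> `|f s| <= M.

Lemma continuous_pos f t : {within `[0, +oo[, continuous f} -> 0 < t -> {for t, continuous f}.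
Proof.
by move=> /continuous_within_itvcyP[cf _] t0; apply: cf; rewrite in_itv/= andbT.
Qed.

Lemma continuous_itv f u : {within `[0, +oo[, continuous f} -> {within `[0, u], continuous f}.
Proof. by apply: continuous_subspaceW => x/=; rewrite !in_itv/= => /andP[->]. Qed.

Lemma continuous_locally_bounded0 f : {within `[0, +oo[, continuous f} -> locally_bounded0 f.
Proof.
move=> cf u; have [u0|u0] := ltP u 0.
  by exists 0 => s /andP[s0 su]; have := lt_trans (lt_le_trans s0 su) u0; rewrite ltxx.
have ct : {within `[0, u], continuous (fun s => `|f s|)}.
  by move=> x; apply: cvg_norm; exact: continuous_itv.
have [c _ cmax] := EVT_max u0 ct.
by exists `|f c| => s /andP[s0 su]; apply: cmax; rewrite in_itv/= su ltW.
Qed.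

Lemma integrable_of_locally_bounded0 f u : {in `]0, +oo[, continuous f} ->
  locally_bounded0 f -> mu.-integrable `]0, u] (EFin \o f).
Proof.
move=> cf bf; apply: measurable_bounded_integrable => //.
- rewrite /= lebesgue_measure_itv/=; case: ifPn => _; rewrite ?ltry//.
- have mf : measurable_fun (`]0, +oo[%classic : set R) f.
    apply: open_continuous_measurable_fun => //.
    by move=> x; rewrite inE; exact: cf.
  apply: measurable_funS mf => //.
  by move=> x/=; rewrite !in_itv/= => /andP[->].
- have [M fM] := bf u; exists M; split; first exact: num_real.
  move=> y My x/=; rewrite in_itv/= => xu; apply: le_trans (fM _ xu) (ltW My).
Qed.

Lemma is_derive_near_eq f g t l : (\forall s \near t, f s = g s) ->
  is_derive t 1 f l -> is_derive t 1 g l.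
Proof.
move=> fg [df dfl]; split; first by apply: near_eq_derivable df.
by rewrite -dfl; apply/esym/near_eq_derive.
Qed.

Lemma near_pos t : 0 < t -> \forall s \near t, 0 < s.
Proof. exact: lt_nbhsr. Qed.

Lemma is_derive_primitive f t : {in `]0, +oo[, continuous f} ->
  locally_bounded0 f -> 0 < t ->
  is_derive t 1 (fun u => \int[mu]_(s in `[0, u]) f s) (f t).
Proof.
move=> cf bf t0.
have tt1 : t < t + 1 by rewrite ltrDl.
have := @continuous_FTC1 _ f (BRight 0) t (t + 1) tt1
  (integrable_of_locally_bounded0 _ cf bf).
move=> /(_ _ _)[].
    exact: t0.
  by apply: cf; rewrite in_itv/= t0.
move=> h1 h2.
apply: (@is_derive_near_eq (fun u => \int[mu]_(s in `]0, u]) f s)).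
  near=> u; apply: Rintegral_itv_obnd_cbnd.
  exact: integrable_of_locally_bounded0.
by apply: (DeriveDef h1); rewrite -derive1E; exact: h2.
Unshelve. all: by end_near. Qed.

Definition average f t : R := t^-1 * \int[mu]_(s in `[0, t]) f s.

Lemma continuous_average f : {within `[0, +oo[, continuous f} ->
  {in `]0, +oo[, continuous (average f)}.
Proof.
move=> cf t; rewrite in_itv/= andbT => t0.
have cf' : {in `]0, +oo[, continuous f}.
  by move=> s; rewrite in_itv/= andbT; exact: continuous_pos.
apply: cvgM; first by apply: inv_continuous; rewrite gt_eqF.
exact: is_derive_continuous (is_derive_primitive cf' (continuous_locally_bounded0 cf) t0).
Qed.

Lemma average_bounded f u M : {within `[0, +oo[, continuous f} ->
  (forall s, 0 <= s <= u -> `|f s| <= M) -> forall s, 0 < s <= u -> `|average f s| <= M.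
Proof.
move=> cf fM s /andP[s0 su].
have sub x : 0 <= x <= s -> 0 <= x <= u by move=> /andP[-> /le_trans->].
rewrite ler_norml; apply/andP; split; last first.
  apply: average_le_cst => //; first exact: continuous_itv.
  by move=> x /sub /fM; rewrite ler_norml => /andP[].
rewrite lerNl /average -mulrN -mulN1r -RintegralZl//; last first.
  exact/continuous_itv_integrable/continuous_itv.
apply: average_le_cst => //.
  move=> x; apply: cvgM; [exact: cvg_cst|exact: continuous_itv].
by move=> x /sub /fM; rewrite mulN1r ler_norml => /andP[+ _]; rewrite lerNl.
Qed.

Lemma average_locally_bounded0 f : {within `[0, +oo[, continuous f} ->
  locally_bounded0 (average f).
Proof.
move=> cf u; have [M fM] := continuous_locally_bounded0 cf u.
exists (Num.max M `|f 0|); apply: average_bounded => // s /andP[s0 su].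
move: s0; rewrite le_eqVlt => /orP[/eqP<-|s0]; first by rewrite le_max lexx orbT.
by rewrite le_max fM// s0.
Qed.

End Averages.

(** * Continuous paths and time averages of vector fields along them *)

Section Paths.
Context {R : realType} {d : nat}.
Implicit Types (X Y : R -> 'rV[R]_d).
Notation mu := (@lebesgue_measure R).

Definition continuous_path X := forall i, {within `[0, +oo[, continuous (fun t => X t 0 i)}.

Lemma within_continuous_sum (A : set R) (n : nat) (h : 'I_n -> R -> R) :
  (forall i, {within A, continuous (h i)}) ->
  {within A, continuous (fun s => \sum_(i < n) h i s)}.
Proof.
move=> ch; elim: (index_enum _) => [|i r IH].
  by under eq_fun do rewrite big_nil; move=> x; exact: cvg_cst.
under eq_fun do rewrite big_cons.
by move=> x; apply: cvgD; [exact: ch|exact: IH].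
Qed.

Lemma continuous_path_dotv X Y : continuous_path X -> continuous_path Y ->
  {within `[0, +oo[, continuous (fun s => dotv (X s) (Y s))}.
Proof.
move=> cX cY; apply: within_continuous_sum => i x.
by apply: cvgM; [exact: cX|exact: cY].
Qed.

Lemma continuous_path_enorm X : continuous_path X ->
  {within `[0, +oo[, continuous (fun s => enorm (X s))}.
Proof.
move=> cX x; apply: (@cvg_comp _ _ _ (fun s => dotv (X s) (X s)) Num.sqrt).
  exact: (continuous_path_dotv cX cX).
exact: sqrt_continuous.
Qed.

Lemma continuous_pathB X Y : continuous_path X -> continuous_path Y ->
  continuous_path (fun s => X s - Y s).
Proof.
move=> cX cY i; rewrite (_ : (fun t => _) = (fun t => X t 0 i - Y t 0 i)); last first.
  by apply/funext => t; rewrite !mxE.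
by move=> x; apply: cvgB; [exact: cX|exact: cY].
Qed.

Lemma continuous_path_cst (v : 'rV[R]_d) : continuous_path (fun=> v).
Proof. by move=> i x; exact: cvg_cst. Qed.

Lemma lipschitz_along_path (F : R -> 'rV[R]_d -> 'rV[R]_d) X (L : R) i :
  (forall s, 0 < s -> forall x y, enorm (F s x - F s y) <= L * enorm (x - y)) ->
  (forall x, {in `]0, +oo[, continuous (fun s => F s x 0 i)}) ->
  (forall x, locally_bounded0 (fun s => F s x 0 i)) ->
  continuous_path X ->
  {in `]0, +oo[, continuous (fun s => F s (X s) 0 i)} /\
  locally_bounded0 (fun s => F s (X s) 0 i).
Proof.
move=> FL cF bF cX.
have key s x : 0 < s -> `|F s (X s) 0 i - F s x 0 i| <= L * enorm (X s - x).
  move=> s0; apply: le_trans (FL _ s0 _ _).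
  by have := ler_coord_enorm (F s (X s) - F s x) i; rewrite !mxE.
split.
  move=> t; rewrite in_itv/= andbT => t0.
  have ct : L * enorm (X s - X t) @[s --> t] --> (0 : R).
    rewrite -[X in _ --> X](mulr0 L); apply: cvgM; first exact: cvg_cst.
    have := @continuous_pos _ _ _ (continuous_path_enorm (continuous_pathB cX (@continuous_path_cst (X t)))) t0.
    rewrite /prop_for /continuous_at subrr (_ : enorm 0 = 0)//.
    by rewrite /enorm /dotv big1 ?sqrtr0// => j _; rewrite mxE mul0r.
  have cFt : F s (X t) 0 i @[s --> t] --> F t (X t) 0 i by apply: cF; rewrite in_itv/= t0.
  apply/cvgrPdist_le => /= e e0.
  have e20 : 0 < e / 2 by rewrite divr_gt0.
  near=> s.
  have s0 : 0 < s by near: s; exact: near_pos.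
  have h1 : `|F t (X t) 0 i - F s (X t) 0 i| <= e / 2.
    by near: s; move/cvgrPdist_le : cFt; apply.
  have h2 : `|0 - L * enorm (X s - X t)| <= e / 2.
    by near: s; move/cvgrPdist_le : ct; apply.
  rewrite sub0r normrN in h2.
  rewrite (splitr e) -(subrK (F s (X t) 0 i) (F t (X t) 0 i)) -addrA.
  rewrite (le_trans (ler_normD _ _))// lerD// distrC (le_trans (key _ _ s0))//.
  exact: le_trans (ler_norm _) h2.
move=> u.
have [M HM] := bF (X 0) u.
have [N HN] := continuous_locally_bounded0 (continuous_path_enorm (continuous_pathB cX (@continuous_path_cst (X 0)))) u.
exists (`|L| * N + M) => s su; have s0 : 0 < s by case/andP: su.
rewrite -(subrK (F s (X 0) 0 i) (F s (X s) 0 i)) (le_trans (ler_normD _ _))// lerD ?HM//.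
rewrite (le_trans (key _ _ s0))// (le_trans (ler_norm _))// normrM ler_wpM2l// HN//.
Unshelve. all: by end_near. Qed.

Lemma time_averageE (f : R -> 'rV[R]_d) t i : 0 < t ->
  time_average f t 0 i = average (fun s => f s 0 i) t.
Proof. by move=> t0; rewrite /time_average gt_eqF// !mxE. Qed.

Lemma time_averageB (f g : R -> 'rV[R]_d) t : 0 < t -> continuous_path f -> continuous_path g ->
  time_average f t - time_average g t = time_average (fun s => f s - g s) t.
Proof.
move=> t0 cf cg; apply/rowP => i; rewrite 2!mxE !time_averageE// /average -mulrBr.
rewrite -RintegralB//; [|exact/continuous_itv_integrable/continuous_itv..].
by congr (_ * _); apply: eq_Rintegral => s _; rewrite !mxE.
Qed.

Lemma sqr_enorm_time_average (f : R -> 'rV[R]_d) (g : R -> R) t : 0 < t ->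
  continuous_path f -> {within `[0, +oo[, continuous g} ->
  (forall s, 0 <= s <= t -> enorm (f s) ^+ 2 <= g s) ->
  enorm (time_average f t) ^+ 2 <= average g t.
Proof.
move=> t0 cf cg fg; rewrite /time_average gt_eqF//.
rewrite sqr_enorm dotvZl dotvZr -sqr_enorm /average ler_wpM2l ?invr_ge0 ?(ltW t0)//.
rewrite ler_pdivrMl//.
apply: sqr_enorm_rVint => //.
- by rewrite /= lebesgue_measure_itv/= lte_fin t0 oppr0 adde0.
- by move=> i; exact/continuous_itv_integrable/continuous_itv.
- exact/continuous_itv_integrable/continuous_itv.
Qed.

End Paths.

(** * The coupled equation along one pair of paths *)

Section Pathwise.
Context {R : realType} {d : nat}.
Implicit Types (X Y : R -> 'rV[R]_d).
Notation mu := (@lebesgue_measure R).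

Lemma is_derive_dotv (x y : R -> 'rV[R]_d) (dx dy : 'rV[R]_d) (t : R) :
  (forall i, is_derive t 1 (fun s => x s 0 i) (dx 0 i)) ->
  (forall i, is_derive t 1 (fun s => y s 0 i) (dy 0 i)) ->
  is_derive t 1 (fun s => dotv (x s) (y s)) (dotv dx (y t) + dotv (x t) dy).
Proof.
move=> Dx Dy; rewrite /dotv.
rewrite (_ : (fun s => _) = \sum_(i < d) ((fun s => x s 0 i) * (fun s => y s 0 i))); last first.
  by apply/funext => s; rewrite fct_sumE.
apply: (is_derive_eq (is_derive_sum (fun i => is_deriveM (Dx i) (Dy i)))).
by rewrite -big_split/=; apply: eq_bigr => i _; rewrite /GRing.scale/=; ring.
Qed.

(** The coefficients of Q are such that the <x, v> terms cancel: 2 (2/gamma + gamma) - 2 gamma -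
    4/gamma = 0. *)
Lemma dotv_drift (gamma : R) (x v r : 'rV[R]_d) : 0 < gamma ->
  let a := - x - gamma *: v + r in
  (2 / gamma + gamma) * (dotv v x + dotv x v) + 2 * (dotv v v + dotv x a)
    + 2 / gamma * (dotv a v + dotv v a)
  = - 2 * dotv x x - 2 * dotv v v + (2 * dotv x r + 4 / gamma * dotv v r).
Proof.
move=> g0 a; rewrite /a !(dotvDl, dotvDr, dotvNl, dotvNr, dotvZl, dotvZr) (dotvC v x) (dotvC r v).
by field; rewrite gt_eqF.
Qed.

(** The remainders come from g, from moving the position in the delay field, and from changing the
    law. The first two cost c_g + c_B and the third another c_B times the same form in |x|, |v|:
    together eta, as required by [lambda1_dissipation]. *)
Lemma drift_dissipation (gamma c_g c_B m : R) (x v r1 r2 r3 : 'rV[R]_d) :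
  let eta := c_g + 2 * c_B in
  0 < gamma -> 0 <= c_g -> 0 <= c_B -> 0 <= m ->
  0 < lambda1 gamma eta ->
  enorm r1 <= c_g * enorm x -> enorm r2 <= c_B * enorm x -> enorm r3 <= c_B * m ->
  - 2 * dotv x x - 2 * dotv v v
    + (2 * dotv x (r1 + r2 + r3) + 4 / gamma * dotv v (r1 + r2 + r3))
  <= - lambda1 gamma eta * Qform gamma x v
     + c_B * ((2 + gamma) ^+ 2 / (2 * gamma * (1 + gamma)) * m ^+ 2).
Proof.
move=> eta g0 cg0 cB0 m0 l0 hr1 hr2 hr3.
have hr : enorm (r1 + r2 + r3) <= (c_g + c_B) * enorm x + c_B * m.
  rewrite (le_trans (ler_enormD _ _))// lerD// mulrDl (le_trans (ler_enormD _ _))//.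
  exact: lerD.
have h1 : 2 * dotv x (r1 + r2 + r3) + 4 / gamma * dotv v (r1 + r2 + r3) <=
   (2 * enorm x + 4 / gamma * enorm v) * ((c_g + c_B) * enorm x + c_B * m).
  have g40 : 0 <= 4 / gamma by rewrite divr_ge0 ?(ltW g0).
  apply: (@le_trans _ _ ((2 * enorm x + 4 / gamma * enorm v) * enorm (r1 + r2 + r3))).
    rewrite (mulrDl (2 * enorm x)) -(mulrA _ (enorm x)) -(mulrA _ (enorm v)).
    by apply: lerD; rewrite ler_wpM2l ?dotv_le.
  by apply: ler_wpM2l => //; apply: addr_ge0; apply: mulr_ge0; rewrite ?enorm_ge0.
have h2 := young_lipschitz (enorm x) (enorm v) g0 (addr_ge0 cg0 cB0).
have h3 := young_drift (enorm x) (enorm v) m g0 cB0.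
have h4 := lambda1_dissipation g0 (addr_ge0 cg0 (mulr_ge0 (ler0n R 2) cB0)) l0
  (dotv_ge0 x) (dotv_ge0 v) (sqr_dotv_le x v).
move: h2 h3 h4; rewrite -/eta /Qform !sqr_enorm => h2 h3 h4.
have E : c_g + c_B = eta - c_B by rewrite /eta; ring.
rewrite mulrDr in h1.
have h5 : (2 * enorm x + 4 / gamma * enorm v) * (c_B * m)
  = c_B * ((2 * enorm x + 4 / gamma * enorm v) * m) by ring.
rewrite {}h5 in h1.
set Q := (X in lambda1 _ _ * X <= _) in h4.
set Y := (X in eta * X) in h4.
rewrite -/Y in h2 h3.
have h6 : (c_g + c_B) * Y + c_B * Y = eta * Y by rewrite /eta; ring.
set K := c_B * (_ * m ^+ 2) in h3 *.
rewrite -/Q [X in _ <= X + _]mulNr.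
move: h1 h2 h3 h4 h6; set U := (X in X <= _ -> _); set U1 := _ * (_ * enorm x); set U2 := c_B * (_ * m).
by clearbody Q Y K U1 U2; rewrite /U; clear; lra.
Qed.

(** The Young constant times the one of [Qform_bound] is the prefactor of [lambda2], and c_B <= eta
    / 2. *)
Lemma delay_coeff (gamma c_g c_B y : R) : 0 < gamma -> 0 <= c_g -> 0 <= y ->
  c_B * ((2 + gamma) ^+ 2 / (2 * gamma * (1 + gamma)) * (2 * gamma / (4 + gamma ^+ 2) * y))
  <= lambda2 gamma (c_g + 2 * c_B) * y.
Proof.
move=> g0 cg0 y0; have s0 : 0 < 4 + gamma ^+ 2 by nra.
rewrite -subr_ge0 /lambda2.
have -> : (2 + gamma) ^+ 2 / ((1 + gamma) * (4 + gamma ^+ 2)) * ((c_g + 2 * c_B) / 2) * y -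
   c_B * ((2 + gamma) ^+ 2 / (2 * gamma * (1 + gamma)) * (2 * gamma / (4 + gamma ^+ 2) * y)) =
   (2 + gamma) ^+ 2 / ((1 + gamma) * (4 + gamma ^+ 2)) * (c_g / 2) * y.
  by field; rewrite (gt_eqF g0) (gt_eqF s0) (gt_eqF (addr_gt0 ltr01 g0)).
apply: mulr_ge0 => //; apply: mulr_ge0; last exact: divr_ge0.
by apply: divr_ge0; [exact: sqr_ge0|apply: mulr_ge0; rewrite ?(ltW s0)// addr_ge0 ?(ltW g0)].
Qed.

Lemma time_average_lipschitz (beta : R -> 'rV[R]_d -> 'rV[R]_d) (c t : R) x y :
  0 <= c -> 0 < t -> (forall x, continuous_path (beta ^~ x)) ->
  (forall s x y, 0 <= s -> enorm (beta s x - beta s y) <= c * enorm (x - y)) ->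
  enorm (time_average (beta ^~ x) t - time_average (beta ^~ y) t) <= c * enorm (x - y).
Proof.
move=> c0 t0 cb bL; rewrite -ler_sqr ?nnegrE ?mulr_ge0 ?enorm_ge0// time_averageB//.
apply: (le_trans (@sqr_enorm_time_average _ _ _ (cst ((c * enorm (x - y)) ^+ 2)) _ t0 _ _ _)).
- by apply: continuous_pathB.
- by move=> z; exact: cvg_cst.
- move=> s /andP[s0 _] /=.
  by rewrite ler_sqr ?nnegrE ?mulr_ge0 ?enorm_ge0// bL.
- rewrite /average Rintegral0_cst ?(ltW t0)//= mulrA mulVf ?mul1r ?gt_eqF//.
Qed.

Variables (gamma c_g c_B : R) (A : 'rV[R]_d -> 'rV[R]_d).
Hypotheses (g0 : 0 < gamma) (cg0 : 0 <= c_g) (cB0 : 0 <= c_B)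
  (HA : structuralA 1 c_g A).

Definition lipschitz_field (beta : R -> 'rV[R]_d -> 'rV[R]_d) :=
  (forall x, continuous_path (beta ^~ x)) /\
  (forall s x y, 0 <= s -> enorm (beta s x - beta s y) <= c_B * enorm (x - y)).

(** The equation at a fixed sample point: the law is present only through the field [beta], and the
    noise is an arbitrary path N, which cancels in the difference of two solutions. *)
Definition pathwise_solution (beta : R -> 'rV[R]_d -> 'rV[R]_d) (N X V : R -> 'rV[R]_d) :=
  [/\ continuous_path X, continuous_path V &
    forall t, 0 <= t ->
      X t = X 0 + rVint mu `[0, t] V /\
      V t = V 0 + rVint mu `[0, t]
        (fun s => A (X s) + time_average (beta ^~ (X s)) s - gamma *: V s) + N t].

Definition drift beta X V s := A (X s) + time_average (beta ^~ (X s)) s - gamma *: V s.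

Lemma drift_regular beta X V i : lipschitz_field beta ->
  continuous_path X -> continuous_path V ->
  {in `]0, +oo[, continuous (fun s => drift beta X V s 0 i)} /\
  locally_bounded0 (fun s => drift beta X V s 0 i).
Proof.
case: HA => _ [g [Ag gL]] [cb bL] cX cV.
have [] := @lipschitz_along_path _ _ (fun s x => A x + time_average (beta ^~ x) s) X (1 + c_g + c_B) i.
- move=> s s0 x y.
  have -> : A x + time_average (beta ^~ x) s - (A y + time_average (beta ^~ y) s) =
     - (x - y) + (g x - g y) + (time_average (beta ^~ x) s - time_average (beta ^~ y) s).
    rewrite !Ag !scale1r; apply/rowP => j; rewrite !mxE; ring.
  rewrite !mulrDl mul1r (le_trans (ler_enormD _ _))// lerD//.
    by rewrite (le_trans (ler_enormD _ _))// enormN lerD.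
  exact: time_average_lipschitz.
- move=> x t t0; have {}t0' : 0 < t by move: t0; rewrite in_itv/= andbT.
  have := @continuous_average _ (fun s => beta s x 0 i) (cb x i) t t0.
  move=> ca.
  have ca' : A x 0 i + average (fun s => beta s x 0 i) s @[s --> t] -->
      A x 0 i + average (fun s => beta s x 0 i) t.
    by apply: cvgD; [exact: cvg_cst|exact: ca].
  rewrite /continuous_at mxE time_averageE//.
  apply: (@cvg_trans _ ((A x 0 i + average (fun s => beta s x 0 i) s) @[s --> t])).
    apply: near_eq_cvg; near=> s; rewrite mxE time_averageE//.
    by near: s; exact: near_pos.
  exact: ca'.
- move=> x u; have [M HM] := average_locally_bounded0 (cb x i) u.
  exists (`|A x 0 i| + M) => s su; have s0 : 0 < s by case/andP: su.
  by rewrite mxE time_averageE// (le_trans (ler_normD _ _))// lerD2l HM.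
- exact: cX.
move=> h1 h2.
have cVi : {within `[0, +oo[, continuous (fun s => V s 0 i)} := cV i.
split.
  move=> t t0; have {}t0' : 0 < t by move: t0; rewrite in_itv/= andbT.
  rewrite (_ : (fun s => _) = (fun s => (A (X s) + time_average (beta ^~ (X s)) s) 0 i - gamma * V s 0 i)).
    apply: cvgB; first exact: h1.
    by apply: cvgM; [exact: cvg_cst|exact: continuous_pos].
  by apply/funext => s; rewrite /drift !mxE.
move=> u; have [M HM] := h2 u; have [N HN] := continuous_locally_bounded0 cVi u.
exists (M + gamma * N) => s su.
rewrite /drift mxE (le_trans (ler_normD _ _))// lerD//; first by have := HM s su.
by rewrite !mxE normrN normrM (gtr0_norm g0) ler_pM2l// HN.
Unshelve. all: by end_near. Qed.

Lemma pathwise_derive beta betah N X V Xh Vh (t : R) i :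
  lipschitz_field beta -> lipschitz_field betah ->
  pathwise_solution beta N X V -> pathwise_solution betah N Xh Vh -> 0 < t ->
  is_derive t 1 (fun s => (X s - Xh s) 0 i) ((V t - Vh t) 0 i) /\
  is_derive t 1 (fun s => (V s - Vh s) 0 i) ((drift beta X V t - drift betah Xh Vh t) 0 i).
Proof.
move=> Lb Lbh [cX cV eqs] [cXh cVh eqsh] t0.
have prim (f : R -> R) : {within `[0, +oo[, continuous f} ->
    is_derive t 1 (fun u => \int[mu]_(s in `[0, u]) f s) (f t).
  move=> cf; apply: is_derive_primitive => //.
    by move=> s; rewrite in_itv/= andbT; exact: continuous_pos.
  exact: continuous_locally_bounded0.
split.
  apply: (@is_derive_near_eq _ (fun s => (X 0 - Xh 0) 0 i +
    (\int[mu]_(r in `[0, s]) V r 0 i - \int[mu]_(r in `[0, s]) Vh r 0 i))).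
    near=> s; have s0 : 0 <= s by apply/ltW; near: s; exact: near_pos.
    have [-> _] := eqs s s0; have [-> _] := eqsh s s0.
    by rewrite /rVint !mxE; ring.
  apply: (is_derive_eq (is_deriveD (is_derive_cst _ t 1) (is_deriveB (prim _ (cV i)) (prim _ (cVh i))))).
  by rewrite !mxE add0r.
have [cd bd] := drift_regular i Lb cX cV.
have [cdh bdh] := drift_regular i Lbh cXh cVh.
apply: (@is_derive_near_eq _ (fun s => (V 0 - Vh 0) 0 i +
    (\int[mu]_(r in `[0, s]) drift beta X V r 0 i - \int[mu]_(r in `[0, s]) drift betah Xh Vh r 0 i))).
  near=> s; have s0 : 0 <= s by apply/ltW; near: s; exact: near_pos.
  have [_ ->] := eqs s s0; have [_ ->] := eqsh s s0.
  by rewrite /rVint !mxE; ring.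
apply: (is_derive_eq (is_deriveD (is_derive_cst _ t 1)
  (is_deriveB (is_derive_primitive cd bd t0) (is_derive_primitive cdh bdh t0)))).
by rewrite !mxE add0r.
Unshelve. all: by end_near. Qed.

(** The field gap is measured by phi + S, whose time average is that of phi plus S. Subtracting the
    equation of phi thus leaves the constant source l2 S. *)
Lemma pathwise_gronwall beta betah N X V Xh Vh phi a S T :
  let eta := c_g + 2 * c_B in
  let l1 := lambda1 gamma eta in
  let l2 := lambda2 gamma eta in
  let q t := Qform gamma (X t - Xh t) (V t - Vh t) in
  0 < l1 -> 0 <= T -> averaged_ode l1 l2 a phi ->
  lipschitz_field beta -> lipschitz_field betah ->
  pathwise_solution beta N X V -> pathwise_solution betah N Xh Vh ->
  (forall s, 0 <= s <= T -> 0 <= phi s + S) ->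
  (forall s x, 0 <= s <= T -> enorm (beta s x - betah s x) ^+ 2
     <= c_B ^+ 2 * (2 * gamma / (4 + gamma ^+ 2) * (phi s + S))) ->
  q T - phi T <= expR (- l1 * T) * (q 0 - phi 0)
                 + (1 - expR (- l1 * T)) * (l2 / l1 * S).
Proof.
move=> eta l1 l2 q l10 T0 [cphi phi0 dphi] Lb Lbh sol solh phiS bbh.
have [cX cV _] := sol; have [cXh cVh _] := solh.
have [_ [g [Ag gL]]] := HA.
have cx := continuous_pathB cX cXh; have cv := continuous_pathB cV cVh.
pose K := 2 * gamma / (4 + gamma ^+ 2).
have K0 : 0 <= K by rewrite divr_ge0 ?mulr_ge0 ?addr_ge0 ?sqr_ge0 ?(ltW g0).
pose x s := X s - Xh s; pose v s := V s - Vh s.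
have qE : q = (fun s => (2 / gamma + gamma) * dotv (x s) (x s)
    + 2 * dotv (x s) (v s) + 2 / gamma * dotv (v s) (v s)).
  by apply/funext => s; rewrite /q /Qform !sqr_enorm.
pose a' t := drift beta X V t - drift betah Xh Vh t.
pose dq t := (2 / gamma + gamma) * (dotv (v t) (x t) + dotv (x t) (v t))
    + 2 * (dotv (v t) (v t) + dotv (x t) (a' t))
    + 2 / gamma * (dotv (a' t) (v t) + dotv (v t) (a' t)).
have Dq (t : R) : 0 < t -> is_derive t 1 q (dq t).
  move=> t0; rewrite qE.
  have Dx i := (pathwise_derive i Lb Lbh sol solh t0).1.
  have Dv i := (pathwise_derive i Lb Lbh sol solh t0).2.
  exact: (is_deriveD (is_deriveD (is_deriveZ _ (is_derive_dotv Dx Dx))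
     (is_deriveZ 2 (is_derive_dotv Dx Dv))) (is_deriveZ _ (is_derive_dotv Dv Dv))).
pose dphi' t := - l1 * phi t + l2 * average phi t.
have cw : {within `[0, T], continuous (q \- phi)}.
  apply: continuous_itv; rewrite qE => s.
  apply: cvgB; last exact: cphi.
  apply: cvgD; first apply: cvgD; (apply: cvgM; first exact: cvg_cst); exact: continuous_path_dotv.
have Df t : 0 < t < T -> is_derive t 1 (q \- phi) (dq t - dphi' t).
  by move=> /andP[t0 _]; exact: (is_deriveB (Dq _ t0) (dphi t t0)).
apply: (linear_gronwall l10 T0 cw Df) => t /andP[t0 tT] /=.
have sub s : 0 <= s <= t -> 0 <= s <= T by move=> /andP[-> /le_trans->]//; exact: ltW.
have cphiS : {within `[0, +oo[, continuous (fun s => phi s + S)}.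
  by move=> s; apply: cvgD; [exact: cphi|exact: cvg_cst].
have avgS : average (fun s => phi s + S) t = average phi t + S.
  rewrite /average RintegralD//; [|exact/continuous_itv_integrable/continuous_itv|]; last first.
    by apply: continuous_itv_integrable => z; exact: cvg_cst.
  by rewrite Rintegral0_cst ?(ltW t0)// mulrDr mulrA mulVf ?mul1r ?gt_eqF.
have avg0 : 0 <= average phi t + S.
  rewrite -avgS mulr_ge0 ?invr_ge0 ?(ltW t0)//.
  by apply: Rintegral_ge0 => s /=; rewrite in_itv/= => /sub; exact: phiS.
(* A bound for the root mean square of the position gap over the history up to t. *)
pose m := Num.sqrt (K * (average phi t + S)).
have m2 : m ^+ 2 = K * (average phi t + S) by rewrite sqr_sqrtr// mulr_ge0.
pose r1 := g (X t) - g (Xh t).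
pose r2 := time_average (beta ^~ (X t)) t - time_average (beta ^~ (Xh t)) t.
pose r3 := time_average (beta ^~ (Xh t)) t - time_average (betah ^~ (Xh t)) t.
have a'E : a' t = - x t - gamma *: v t + (r1 + r2 + r3).
  rewrite /a' /drift !Ag !scale1r; apply/rowP => i; rewrite !mxE; ring.
have hr3 : enorm r3 <= c_B * m.
  rewrite -ler_sqr ?nnegrE ?mulr_ge0 ?enorm_ge0 ?sqrtr_ge0//.
  rewrite /r3 time_averageB//; [|exact: Lb.1|exact: Lbh.1].
  apply: (le_trans (@sqr_enorm_time_average _ _ _
      (fun s => c_B ^+ 2 * (K * (phi s + S))) _ t0 _ _ _)).
  - by apply: continuous_pathB; [exact: Lb.1|exact: Lbh.1].
  - move=> s; apply: cvgM; first exact: cvg_cst.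
    by apply: cvgM; [exact: cvg_cst|exact: cphiS].
  - by move=> s /sub sT; exact: bbh.
  - rewrite exprMn m2 -avgS /average.
    under eq_Rintegral do rewrite mulrA.
    rewrite RintegralZl//; last exact/continuous_itv_integrable/continuous_itv.
    by rewrite le_eqVlt; apply/orP; left; apply/eqP; ring.
have hr2 : enorm r2 <= c_B * enorm (x t).
  by apply: time_average_lipschitz => //; [exact: Lb.1|exact: Lb.2].
have := @drift_dissipation gamma c_g c_B m (x t) (v t) r1 r2 r3 g0 cg0 cB0 (sqrtr_ge0 _) l10 (gL _ _) hr2 hr3.
rewrite -dotv_drift// -a'E -/(dq t) m2 -/eta -/l1 => h1.
have := delay_coeff c_B g0 cg0 avg0; rewrite -/K -/eta -/l2 => h2.
rewrite /dphi' /q -/(x t) -/(v t); clear -h1 h2; lra.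
Qed.

End Pathwise.

(** * Continuity and Borel measurability of functions of a vector *)

Section EuclideanMeasurability.
Context {R : realType} {d : nat}.
Implicit Types (x y v : 'rV[R]_d).

Lemma continuous_enormB x : continuous (fun y => enorm (y - x)).
Proof.
have cs : continuous (fun y => dotv (y - x) (y - x)).
  rewrite /dotv; elim: (index_enum _) => [|i r IH].
    rewrite (_ : (fun y => _) = (fun _ : 'rV[R]_d => 0 : R)); first exact: cst_continuous.
    by apply/funext => y; rewrite big_nil.
  under eq_fun do rewrite big_cons.
  have ci : continuous (fun y : 'rV[R]_d => (y - x) 0 i).
    rewrite (_ : (fun y => _) = (fun y => y 0 i - x 0 i)); last first.
      by apply/funext => y; rewrite !mxE.
    move=> y; apply: (@continuousB _ _ _ (fun y : 'rV[R]_d => y 0 i) (cst (x 0 i))).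
      exact: coord_continuous.
    exact: cst_continuous.
  move=> y; apply: (@continuousD _ _ _ (fun y : 'rV[R]_d => (y - x) 0 i * (y - x) 0 i)
    (fun y : 'rV[R]_d => \sum_(j <- r) (y - x) 0 j * (y - x) 0 j)); last exact: IH.
  by apply: (@continuousM _ _ (fun y : 'rV[R]_d => (y - x) 0 i) (fun y : 'rV[R]_d => (y - x) 0 i)); exact: ci.
move=> y; apply: (@cvg_comp _ _ _ (fun y => dotv (y - x) (y - x)) Num.sqrt).
  exact: cs.
exact: sqrt_continuous.
Qed.

(** The topology on rows is that of the sup norm, so the passage from Euclidean estimates goes
    through [continuous_enormB]. *)
Lemma lipschitz_continuous (f : 'rV[R]_d -> R) (L : R) :
  (forall x y, `|f x - f y| <= L * enorm (x - y)) -> continuous f.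
Proof.
move=> fL x.
have h : L * enorm (y - x) @[y --> x] --> (0 : R).
  rewrite -[X in _ --> X](mulr0 L); apply: (@cvgM _ _ (nbhs (x : 'rV[R]_d)) _ (cst L) (fun y : 'rV[R]_d => enorm (y - x))); first exact: cvg_cst.
  have := @continuous_enormB x x.
  rewrite /continuous_at subrr (_ : enorm 0 = 0)//.
  by rewrite /enorm /dotv big1 ?sqrtr0// => j _; rewrite mxE mul0r.
have hx : Filter (nbhs (x : 'rV[R]_d)) by exact: nbhs_filter.
apply/(@cvgrPdist_le _ _ _ _ hx) => e e0; near=> y.
rewrite distrC; apply: le_trans (fL _ _) _.
have : `|0 - L * enorm (y - x)| <= e by near: y; move/(@cvgrPdist_le _ _ _ _ hx) : h; apply.
by rewrite sub0r normrN; apply: le_trans (ler_norm _).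
Unshelve. all: by end_near. Qed.

Lemma measurable_continuous_Rd (f : 'rV[R]_d -> R) : continuous f ->
  measurable_fun [set: Rd R d] (f : Rd R d -> R).
Proof.
move=> cf; apply: (measurability (@RGenOInfty.G R)).
  exact: RGenOInfty.measurableE.
move=> _ [_ [a ->] <-]; rewrite setTI.
apply: sub_sigma_algebra; apply: open_comp; last exact: interval_open.
by move=> y _; exact: cf.
Qed.

Lemma measurable_coord i : measurable_fun [set: Rd R d] (fun x : Rd R d => (x : 'rV[R]_d) 0 i).
Proof. by apply: measurable_continuous_Rd => x; exact: coord_continuous. Qed.

End EuclideanMeasurability.

(** * Square-integrable random vectors *)

Section RandomVectors.
Context {R : realType} {d : nat} (disp : measure_display) (E : measurableType disp).
Implicit Types (Y : E -> 'rV[R]_d).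

Definition measurable_rV Y := forall i, measurable_fun setT (fun e => Y e 0 i).

Lemma measurable_rVB Y1 Y2 : measurable_rV Y1 -> measurable_rV Y2 ->
  measurable_rV (fun e => Y1 e - Y2 e).
Proof.
move=> m1 m2 i; rewrite (_ : (fun e => _) = (fun e => Y1 e 0 i - Y2 e 0 i)); last first.
  by apply/funext => e; rewrite !mxE.
exact: measurable_funB.
Qed.

Lemma measurable_dotv Y1 Y2 : measurable_rV Y1 -> measurable_rV Y2 ->
  measurable_fun setT (fun e => dotv (Y1 e) (Y2 e)).
Proof. by move=> m1 m2; apply: measurable_sum => i; exact: measurable_funM. Qed.

Lemma measurable_sqr_enorm Y : measurable_rV Y ->
  measurable_fun setT (fun e => enorm (Y e) ^+ 2).
Proof.
move=> mY; under eq_fun do rewrite sqr_enorm; exact: measurable_dotv.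
Qed.

Lemma measurable_rV_of (Y : E -> Rd R d) : measurable_fun setT Y -> measurable_rV Y.
Proof. by move=> mY i; exact: (measurableT_comp (measurable_coord i) mY). Qed.

Definition square_integrable (Q : probability E R) Y :=
  measurable_rV Y /\ (\int[Q]_e (enorm (Y e) ^+ 2)%:E < +oo)%E.

Lemma integrable_sqr_enorm (Q : probability E R) Y : square_integrable Q Y ->
  Q.-integrable setT (EFin \o (fun e => enorm (Y e) ^+ 2)).
Proof.
move=> [mY fY]; apply/integrableP; split.
  by apply/measurable_EFinP; exact: measurable_sqr_enorm.
by under eq_integral do rewrite /= ger0_norm ?sqr_ge0//.
Qed.

Lemma integrable_probability_cst (Q : probability E R) (c : R) :
  Q.-integrable setT (EFin \o cst c).
Proof.
by apply: measurable_bounded_integrable => //=;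
  rewrite ?probability_setT ?ltry//; exact: bounded_cst.
Qed.

Lemma integral_sqr_enorm_le (Q : probability E R) Y Y1 Y2 :
  measurable_rV Y -> measurable_rV Y1 -> measurable_rV Y2 ->
  (forall e, enorm (Y e) ^+ 2 <= 2 * (enorm (Y1 e) ^+ 2 + enorm (Y2 e) ^+ 2)) ->
  (\int[Q]_e (enorm (Y e) ^+ 2)%:E <=
    2%:E * (\int[Q]_e (enorm (Y1 e) ^+ 2)%:E + \int[Q]_e (enorm (Y2 e) ^+ 2)%:E))%E.
Proof.
move=> m m1 m2 YY.
have mm Z : measurable_rV Z -> measurable_fun setT (fun e => (enorm (Z e) ^+ 2)%:E).
  by move=> mZ; apply/measurable_EFinP; exact: measurable_sqr_enorm.
have p0 Z (e : E) : (0 <= (enorm (Z e : 'rV[R]_d) ^+ 2)%:E)%E by rewrite lee_fin sqr_ge0.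
rewrite -ge0_integralD//; [|exact: mm..].
rewrite -ge0_integralZl//; last 2 first.
  by apply: emeasurable_funD; exact: mm.
  by move=> e _; rewrite -EFinD lee_fin addr_ge0 ?sqr_ge0.
apply: ge0_le_integral => //.
- exact: mm.
- by apply: measurable_funeM; apply: emeasurable_funD; exact: mm.
- by move=> e _; rewrite -EFinD -EFinM lee_fin.
Qed.

Lemma square_integrableB (Q : probability E R) Y1 Y2 :
  square_integrable Q Y1 -> square_integrable Q Y2 ->
  square_integrable Q (fun e => Y1 e - Y2 e).
Proof.
move=> [m1 f1] [m2 f2]; have mB := measurable_rVB m1 m2; split=> //.
apply: (le_lt_trans (integral_sqr_enorm_le Q mB m1 m2 _)).
  by move=> e; rewrite -[enorm (Y2 e)]enormN sqr_enormD_le.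
by apply: lte_mul_pinfty => //; apply: lte_add_pinfty.
Qed.

Lemma integrable_lipschitz_comp (Q : probability E R) (Y : E -> Rd R d)
    (f : 'rV[R]_d -> R) (L : R) :
  0 <= L -> (forall x y, `|f x - f y| <= L * enorm (x - y)) ->
  measurable_fun setT Y -> square_integrable Q Y ->
  Q.-integrable setT (EFin \o (fun e => f (Y e))).
Proof.
move=> L0 fL mY sY.
(* From |f(y)| <= |f(0)| + L |y| and |y| <= 1 + |y|^2. *)
pose g e := (`|f 0| + L) + L * enorm (Y e : 'rV[R]_d) ^+ 2.
have gi : Q.-integrable setT (EFin \o g).
  have h1 := integrable_probability_cst Q (`|f 0| + L).
  have h2 := @integrableZl _ _ _ Q _ measurableT L _ (integrable_sqr_enorm sY).
  exact: (integrableD measurableT h1 h2).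
apply: (le_integrable measurableT _ _ gi).
  apply/measurable_EFinP; apply: (measurableT_comp _ mY).
  exact: measurable_continuous_Rd (lipschitz_continuous fL).
move=> e _; rewrite /= lee_fin.
have g0 : 0 <= g e.
  by rewrite /g; apply: addr_ge0; [exact: addr_ge0|rewrite mulr_ge0 ?sqr_ge0].
rewrite (ger0_norm g0) /g -addrA.
rewrite -(subrKC (f 0) (f (Y e))) (le_trans (ler_normD _ _))// lerD2l.
rewrite (le_trans (fL _ _))// subr0 -{2}[L]mulr1 -mulrDr ler_wpM2l//.
have := sqr_ge0 (enorm (Y e : 'rV[R]_d) - 1); have := sqr_ge0 (enorm (Y e : 'rV[R]_d)).
nra.
Qed.

Lemma rVintB (Q : probability E R) Y1 Y2 :
  integrable_rV Q setT Y1 -> integrable_rV Q setT Y2 ->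
  rVint Q setT Y1 - rVint Q setT Y2 = rVint Q setT (fun e => Y1 e - Y2 e).
Proof.
move=> i1 i2; apply/rowP => i; rewrite !mxE -RintegralB//; try exact: i1; try exact: i2.
by apply: eq_Rintegral => e _; rewrite !mxE.
Qed.

End RandomVectors.

(* [Defs] already declares [fst] measurable, at the type [phase R d -> Rd R d]
   only. *)
Definition left_phase {R : realType} {d : nat} (p : phase R d * phase R d) : phase R d := p.1.
Definition right_phase {R : realType} {d : nat} (p : phase R d * phase R d) : phase R d := p.2.

HB.instance Definition _ (R : realType) (d : nat) :=
  isMeasurableFun.Build _ _ (phase R d * phase R d)%type (phase R d) left_phase measurable_fst.
HB.instance Definition _ (R : realType) (d : nat) :=
  isMeasurableFun.Build _ _ (phase R d * phase R d)%type (phase R d) right_phase measurable_snd.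

(** * Positions and velocities of random phase points *)

Section Marginals.
Context {R : realType} {d : nat}.

(** The probability space is left free: the same lemmas serve the sample space with the two
    solutions, and a coupling measure with its two projections. *)
Definition has_law (disp : measure_display) (E : measurableType disp)
    (Q : probability E R) (mu : probability (phase R d) R) (Y : {mfun E >-> phase R d}) :=
  forall C, measurable C -> mu C = Q (Y @^-1` C).

Context (disp : measure_display) (E : measurableType disp) (Q : probability E R).
Implicit Types (mu nu : probability (phase R d) R) (Y : {mfun E >-> phase R d}).

Definition position Y (e : E) : Rd R d := (Y e).1.
Definition velocity Y (e : E) : Rd R d := (Y e).2.

Lemma measurable_position Y : measurable_fun setT (position Y).
Proof. exact: (measurableT_comp measurable_fst). Qed.

Lemma measurable_velocity Y : measurable_fun setT (velocity Y).
Proof. exact: (measurableT_comp measurable_snd). Qed.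

Lemma measurable_sqnorm2 : measurable_fun [set: phase R d] (fun z => sqnorm2 z).
Proof.
apply: measurable_funD; apply: measurable_sqr_enorm; apply: measurable_rV_of.
  exact: measurable_fst.
exact: measurable_snd.
Qed.

Lemma integral_sqnorm2_law mu Y : has_law Q mu Y ->
  (\int[mu]_z (sqnorm2 z)%:E =
   \int[Q]_e (enorm (position Y e : 'rV[R]_d) ^+ 2)%:E +
   \int[Q]_e (enorm (velocity Y e : 'rV[R]_d) ^+ 2)%:E)%E.
Proof.
move=> YL.
have mY : measurable_fun setT Y by [].
transitivity (\int[distribution Q Y]_z (sqnorm2 z)%:E)%E.
  by apply: eq_measure_integral => C mC _; exact: (YL C mC).
rewrite ge0_integral_pushforward//; last 2 first.
  by apply/measurable_EFinP; exact: measurable_sqnorm2.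
  by move=> z _; rewrite lee_fin addr_ge0 ?sqr_ge0.
rewrite preimage_setT.
under eq_integral do rewrite /= /sqnorm2 EFinD.
rewrite ge0_integralD//.
- by move=> e _; rewrite lee_fin sqr_ge0.
- by apply/measurable_EFinP; apply: measurable_sqr_enorm; apply: measurable_rV_of; exact: measurable_position.
- by move=> e _; rewrite lee_fin sqr_ge0.
- by apply/measurable_EFinP; apply: measurable_sqr_enorm; apply: measurable_rV_of; exact: measurable_velocity.
Qed.

Lemma P2_square_integrable mu Y : has_law Q mu Y -> P2 mu ->
  square_integrable Q (position Y) /\ square_integrable Q (velocity Y).
Proof.
move=> YL; rewrite /P2/= (integral_sqnorm2_law YL) => h.
have p0 : (0 <= \int[Q]_e (enorm (position Y e : 'rV[R]_d) ^+ 2)%:E)%E.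
  by apply: integral_ge0 => e _; rewrite lee_fin sqr_ge0.
have v0 : (0 <= \int[Q]_e (enorm (velocity Y e : 'rV[R]_d) ^+ 2)%:E)%E.
  by apply: integral_ge0 => e _; rewrite lee_fin sqr_ge0.
split; split.
- by apply: measurable_rV_of; exact: measurable_position.
- by apply: le_lt_trans h; rewrite leeDl.
- by apply: measurable_rV_of; exact: measurable_velocity.
- by apply: le_lt_trans h; rewrite leeDr.
Qed.

Lemma Rintegral_position_marginal mu Y (f : 'rV[R]_d -> R) : has_law Q mu Y ->
  measurable_fun [set: Rd R d] (f : Rd R d -> R) ->
  Q.-integrable setT (EFin \o (fun e => f (position Y e))) ->
  \int[position_marginal mu]_x f x = \int[Q]_e f (position Y e).
Proof.
move=> YL mf fi; rewrite /Rintegral; congr fine.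
transitivity (\int[distribution Q (fst \o Y : {mfun E >-> Rd R d})]_x (f x)%:E)%E.
  apply: eq_measure_integral => C mC _.
  apply: (YL (fst @^-1` C)).
  by rewrite -[X in measurable X]setTI; exact: measurable_fst.
rewrite integral_distribution//.
by apply/measurable_EFinP.
Qed.

End Marginals.

(** * The mean interaction field and its dependence on the law *)

Section InteractionField.
Context {R : realType} {d : nat} (c_B : R) (B : 'rV[R]_d -> 'rV[R]_d -> 'rV[R]_d).
Hypotheses (cB0 : 0 <= c_B) (HB : structuralB c_B B).
Implicit Types (mu nu : probability (phase R d) R).

Definition mean_field mu x := rVint (position_marginal mu) setT (B x).

Lemma coordB (x y : 'rV[R]_d) i : (x - y) 0 i = x 0 i - y 0 i.
Proof. by rewrite !mxE. Qed.

Lemma structuralB_l x y xh : enorm (B x xh - B y xh) <= c_B * enorm (x - y).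
Proof.
have e0 : enorm (0 : 'rV[R]_d) = 0 by rewrite /enorm /dotv big1 ?sqrtr0// => j _; rewrite mxE mul0r.
have := HB x xh y xh; rewrite !subrr !e0 !addr0//.
Qed.

Lemma structuralB_r x xh yh : enorm (B x xh - B x yh) <= c_B * enorm (xh - yh).
Proof.
have e0 : enorm (0 : 'rV[R]_d) = 0 by rewrite /enorm /dotv big1 ?sqrtr0// => j _; rewrite mxE mul0r.
have := HB x xh x yh; rewrite !subrr !e0 !add0r//.
Qed.

Lemma structuralB_coord x i xh yh : `|B x xh 0 i - B x yh 0 i| <= c_B * enorm (xh - yh).
Proof.
apply: le_trans (structuralB_r x xh yh).
by have := ler_coord_enorm (B x xh - B x yh) i; rewrite !mxE.
Qed.

Lemma integrable_mean_field (disp : measure_display) (E : measurableType disp)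
    (Q : probability E R) mu (Y : {mfun E >-> phase R d}) x : has_law Q mu Y -> P2 mu ->
  integrable_rV Q setT (fun e => B x (position Y e)).
Proof.
move=> YL P2mu i.
apply: (@integrable_lipschitz_comp _ _ _ _ _ (position Y) (fun y => B x y 0 i) c_B) => //.
- by move=> y z; exact: structuralB_coord.
- exact: measurable_position.
- exact: (P2_square_integrable YL P2mu).1.
Qed.

Lemma mean_fieldE (disp : measure_display) (E : measurableType disp)
    (Q : probability E R) mu (Y : {mfun E >-> phase R d}) x : has_law Q mu Y -> P2 mu ->
  mean_field mu x = rVint Q setT (fun e => B x (position Y e)).
Proof.
move=> YL P2mu; apply/rowP => i; rewrite !mxE.
apply: (Rintegral_position_marginal YL (f := fun y => B x y 0 i)).
  apply: measurable_continuous_Rd; apply: (@lipschitz_continuous _ _ _ c_B) => y z.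
  exact: structuralB_coord.
exact: integrable_mean_field YL P2mu i.
Qed.

(** Realising both laws on one space turns the difference into the mean of B(x, Y1) - B(x, Y2), to
    which Jensen and the Lipschitz bound of B apply. *)
Lemma mean_field_gap (disp : measure_display) (E : measurableType disp)
    (Q : probability E R) mu nu (Y1 Y2 : {mfun E >-> phase R d}) x :
  has_law Q mu Y1 -> has_law Q nu Y2 -> P2 mu -> P2 nu ->
  enorm (mean_field mu x - mean_field nu x) ^+ 2 <=
  c_B ^+ 2 * \int[Q]_e (enorm (position Y1 e - position Y2 e : 'rV[R]_d) ^+ 2).
Proof.
move=> L1 L2 P1 P2'; rewrite (mean_fieldE x L1 P1) (mean_fieldE x L2 P2').
have i1 := integrable_mean_field x L1 P1; have i2 := integrable_mean_field x L2 P2'.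
have sB := square_integrableB (P2_square_integrable L1 P1).1 (P2_square_integrable L2 P2').1.
have gi := integrable_sqr_enorm sB.
rewrite rVintB// -RintegralZl// -[leRHS]mul1r.
apply: sqr_enorm_rVint => //.
- exact: probability_setT.
- move=> i; rewrite (_ : (EFin \o _) = (fun e => (B x (position Y1 e) 0 i)%:E - (B x (position Y2 e) 0 i)%:E)%E).
    by apply: integrableB => //; [exact: i1|exact: i2].
  by apply/funext => e; rewrite /= !mxE EFinB.
- by have := @integrableZl _ _ _ Q _ measurableT (c_B ^+ 2) _ gi.
- move=> e _; rewrite -exprMn ler_sqr ?nnegrE ?mulr_ge0 ?enorm_ge0//.
  exact: structuralB_r.
Qed.

Lemma mean_field_lipschitz (disp : measure_display) (E : measurableType disp)
    (Q : probability E R) mu (Y : {mfun E >-> phase R d}) x y : has_law Q mu Y -> P2 mu ->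
  enorm (mean_field mu x - mean_field mu y) <= c_B * enorm (x - y).
Proof.
move=> YL P2mu; rewrite -ler_sqr ?nnegrE ?mulr_ge0 ?enorm_ge0//.
rewrite (mean_fieldE x YL P2mu) (mean_fieldE y YL P2mu).
have i1 := integrable_mean_field x YL P2mu; have i2 := integrable_mean_field y YL P2mu.
rewrite rVintB//.
have -> : (c_B * enorm (x - y)) ^+ 2 = 1 * \int[Q]_e ((c_B * enorm (x - y)) ^+ 2).
  rewrite Rintegral_cst// [X in fine X](_ : _ = 1%E); last exact: probability_setT.
  by rewrite mulr1 mul1r.
apply: sqr_enorm_rVint => //.
- exact: probability_setT.
- move=> i; rewrite (_ : (EFin \o _) = (fun e => (B x (position Y e) 0 i)%:E - (B y (position Y e) 0 i)%:E)%E).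
    by apply: integrableB => //; [exact: i1|exact: i2].
  by apply/funext => e; rewrite /= !mxE EFinB.
- exact: integrable_probability_cst.
- move=> e _; rewrite ler_sqr ?nnegrE ?mulr_ge0 ?enorm_ge0//.
  exact: structuralB_l.
Qed.

Lemma coupling_has_law mu nu pi : coupling mu nu pi ->
  has_law pi mu left_phase /\
  has_law pi nu right_phase.
Proof.
move=> cpi; split=> C mC.
  rewrite -(cpi C mC).1; congr (pi _); apply/seteqP; split => [p []//|p pC]; split=> //.
rewrite -(cpi C mC).2; congr (pi _); apply/seteqP; split => [p []//|p pC]; split=> //.
Qed.

(** A strict bound on the infimum yields a competitor below it, so no optimal coupling has to
    exist. *)
Lemma W2_lt_coupling mu nu (e : R) : 0 < e -> (W2 mu nu < e%:E)%E ->
  exists2 pi, coupling mu nu pi &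
    (\int[pi]_p (enorm (p.1.1 - p.2.1 : 'rV[R]_d) ^+ 2
                 + enorm (p.1.2 - p.2.2 : 'rV[R]_d) ^+ 2)%:E < (e ^+ 2)%:E)%E.
Proof.
move=> e0 W2e.
have : (ereal_inf [set \int[pi]_p (enorm (p.1.1 - p.2.1 : 'rV[R]_d) ^+ 2
                 + enorm (p.1.2 - p.2.2 : 'rV[R]_d) ^+ 2)%:E | pi in coupling mu nu] < (e ^+ 2)%:E)%E.
  rewrite ltNge; apply/negP => h; move: W2e; apply/negP; rewrite -leNgt /W2.
  have -> : (e%:E = (e ^+ 2)%:E `^ 2^-1)%E.
    rewrite poweR_EFin -powR_mulrn ?(ltW e0)// -powRrM mulfV ?powRr1 ?(ltW e0)//.
  apply: gt0_ler_poweR => //.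
  - by rewrite in_itv/= lee_fin sqr_ge0 leey.
  - by rewrite in_itv/= leey andbT (le_trans _ h)// lee_fin sqr_ge0.
by move=> /ereal_inf_lt[_ [pi cpi <-] h]; exists pi.
Qed.

Lemma fine_le_of_lt (A : \bar R) (r : R) : (0 <= A)%E -> (A < r%:E)%E -> fine A <= r.
Proof. by case: A => //= a _; rewrite lte_fin => /ltW. Qed.

Definition gap_position (p : phase R d * phase R d) : 'rV[R]_d := p.1.1 - p.2.1.
Definition gap_velocity (p : phase R d * phase R d) : 'rV[R]_d := p.1.2 - p.2.2.

Lemma measurable_gap : measurable_rV gap_position /\ measurable_rV gap_velocity.
Proof.
split; apply: measurable_rVB; apply: measurable_rV_of.
- exact: (measurableT_comp measurable_fst measurable_fst).
- exact: (measurableT_comp measurable_fst measurable_snd).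
- exact: (measurableT_comp measurable_snd measurable_fst).
- exact: (measurableT_comp measurable_snd measurable_snd).
Qed.

Lemma integral_gap (pi : probability (phase R d * phase R d)%type R) :
  (\int[pi]_p (enorm (p.1.1 - p.2.1 : 'rV[R]_d) ^+ 2
                 + enorm (p.1.2 - p.2.2 : 'rV[R]_d) ^+ 2)%:E =
   \int[pi]_p (enorm (gap_position p) ^+ 2)%:E + \int[pi]_p (enorm (gap_velocity p) ^+ 2)%:E)%E.
Proof.
have [mp mv] := measurable_gap.
rewrite -ge0_integralD//.
- by move=> p _; rewrite lee_fin sqr_ge0.
- by apply/measurable_EFinP; exact: measurable_sqr_enorm.
- by move=> p _; rewrite lee_fin sqr_ge0.
- by apply/measurable_EFinP; exact: measurable_sqr_enorm.
Qed.

Lemma mean_field_W2 mu nu x (e : R) : P2 mu -> P2 nu -> 0 < e -> (W2 mu nu < e%:E)%E ->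
  enorm (mean_field mu x - mean_field nu x) <= c_B * e.
Proof.
move=> P2mu P2nu e0 /W2_lt_coupling[]// pi /coupling_has_law[L1 L2].
rewrite integral_gap => h.
rewrite -ler_sqr ?nnegrE ?mulr_ge0 ?enorm_ge0 ?(ltW e0)//.
apply: (le_trans (mean_field_gap x L1 L2 P2mu P2nu)).
rewrite exprMn ler_wpM2l ?sqr_ge0//.
apply: fine_le_of_lt; first by apply: integral_ge0 => p _; rewrite lee_fin sqr_ge0.
apply: le_lt_trans h; rewrite leeDl//.
by apply: integral_ge0 => p _; rewrite lee_fin sqr_ge0.
Qed.

Lemma near_W2 (mu : R -> probability (phase R d) R) (t e : R) :
  continuous_P2 mu -> 0 <= t -> 0 < e ->
  \forall s \near within `[0, +oo[ (nbhs t), 0 <= s /\ (W2 (mu s) (mu t) < e%:E)%E.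
Proof.
move=> [_ cmu] t0 e0; apply: filterI.
  apply: (@filterS _ _ _ `[0%R, +oo[%classic); last exact: withinT.
  by move=> s /=; rewrite in_itv/= andbT.
apply: (cmu t t0 [set y | (y < e%:E)%E]).
by apply: open_nbhs_nbhs; split; [exact: open_ereal_lt_ereal|rewrite /= lte_fin].
Qed.

Lemma continuous_mean_field (mu : R -> probability (phase R d) R) x :
  continuous_P2 mu -> continuous_path (fun s => mean_field (mu s) x).
Proof.
move=> cmu i; apply/subspace_continuousP => t; rewrite /= in_itv/= andbT => t0.
have [P2mu _] := cmu.
apply/cvgrPdist_le => e e0.
(* The radius e / (c_B + 1) also covers c_B = 0. *)
have c1 : 0 < c_B + 1 by rewrite ltr_wpDl.
have := near_W2 cmu t0 (divr_gt0 e0 c1); apply: filterS => s [s0 h].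
have := mean_field_W2 x (P2mu s s0) (P2mu t t0) (divr_gt0 e0 c1) h => h1.
rewrite distrC; have := ler_coord_enorm (mean_field (mu s) x - mean_field (mu t) x) i.
rewrite coordB => h2; apply: (le_trans h2); apply: (le_trans h1).
rewrite mulrCA ler_piMr ?(ltW e0)// ler_pdivrMr// mul1r lerDl//.
Qed.

Lemma sqnorm2_W2 mu nu : P2 mu -> P2 nu -> (W2 mu nu < 1%:E)%E ->
  (\int[mu]_z (sqnorm2 z)%:E <= 2%:E * (1%:E + \int[nu]_z (sqnorm2 z)%:E))%E.
Proof.
move=> P2mu P2nu /W2_lt_coupling[]// pi /coupling_has_law[L1 L2].
rewrite integral_gap expr1n (integral_sqnorm2_law L1) (integral_sqnorm2_law L2) => h.
have [mp mv] := measurable_gap.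
have mpos (Y : {mfun (phase R d * phase R d)%type >-> phase R d}) : measurable_rV (position Y).
  by apply: measurable_rV_of; exact: measurable_position.
have mvel (Y : {mfun (phase R d * phase R d)%type >-> phase R d}) : measurable_rV (velocity Y).
  by apply: measurable_rV_of; exact: measurable_velocity.
have hp := integral_sqr_enorm_le pi (mpos left_phase) mp (mpos right_phase) _.
have hv := integral_sqr_enorm_le pi (mvel left_phase) mv (mvel right_phase) _.
apply: (le_trans (leeD (hp _) (hv _))).
- by move=> p; rewrite -{1}(subrK (p.2.1 : 'rV[R]_d) (position left_phase p)) sqr_enormD_le.
- by move=> p; rewrite -{1}(subrK (p.2.2 : 'rV[R]_d) (velocity left_phase p)) sqr_enormD_le.
have i0 (Z : phase R d * phase R d -> 'rV[R]_d) : (0 <= \int[pi]_p (enorm (Z p) ^+ 2)%:E)%E.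
  by apply: integral_ge0 => p _; rewrite lee_fin sqr_ge0.
rewrite -ge0_muleDr; try by apply: adde_ge0; exact: i0.
rewrite lee_pmul2l// addeACA leeD2r//.
exact: ltW.
Qed.

Lemma sqnorm2_locally_bounded (mu : R -> probability (phase R d) R) (T : R) :
  continuous_P2 mu -> exists M : R, forall s, 0 <= s <= T ->
    (\int[mu s]_z (sqnorm2 z)%:E <= M%:E)%E.
Proof.
move=> cmu; have [P2mu _] := cmu.
have cT : compact (`[0, T] : set R) by exact: segment_compact.
(* Near each t the laws are at distance below 1 from that at t, so by [sqnorm2_W2] every large M
   bounds their second moments; compactness makes M uniform. *)
move/compact_near_coveringP : cT => /(_ R (pinfty_nbhs R)
  (fun M s => 0 <= s -> (\int[mu s]_z (sqnorm2 z)%:E <= M%:E)%E) _)[].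
  move=> t; rewrite /= in_itv/= => /andP[t0 _].
  have fin : (2%:E * (1%:E + \int[mu t]_z (sqnorm2 z)%:E))%E \is a fin_num.
    rewrite fin_numM// fin_numD/= ge0_fin_numE.
      exact: P2mu.
    by apply: integral_ge0 => z _; rewrite lee_fin addr_ge0 ?sqr_ge0.
  exists ([set s | 0 <= s -> (W2 (mu s) (mu t) < 1%:E)%E],
     [set M | fine (2%:E * (1%:E + \int[mu t]_z (sqnorm2 z)%:E))%E <= M]); first split => /=.
  - have := near_W2 cmu t0 ltr01; rewrite near_withinE; apply: filterS => s h s0.
    by apply h; rewrite /= in_itv/= s0.
  - by apply: nbhs_pinfty_ge; exact: num_real.
  - move=> [s M]/= [h1 h2] s0.
    apply: (le_trans (sqnorm2_W2 (P2mu s s0) (P2mu t t0) (h1 s0))).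
    by rewrite -(fineK fin) lee_fin.
move=> M [_ h]; exists (M + 1) => s /andP[s0 sT]; apply: h => //.
  by rewrite ltrDl.
by rewrite /= in_itv/= s0.
Qed.

End InteractionField.

(** * Expectation of Q under the synchronous coupling, and comparison with phi *)

Section Coupling.
Context {R : realType} {d : nat} {disp : measure_display}
  {T : measurableType disp} (P : probability T R).
Variables (gamma sigma c_g c_B : R) (A : 'rV[R]_d -> 'rV[R]_d)
  (B : 'rV[R]_d -> 'rV[R]_d -> 'rV[R]_d) (W : R -> {RV P >-> Rd R d})
  (Z Zh : R -> {RV P >-> phase R d}).
Hypotheses (g0 : 0 < gamma) (cg0 : 0 <= c_g) (cB0 : 0 <= c_B)
  (HA : structuralA 1 c_g A) (HB : structuralB c_B B)
  (solZ : delay_mean_field_solution gamma sigma A B W Z)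
  (solZh : delay_mean_field_solution gamma sigma A B W Zh).

Lemma law_has_law (Y : R -> {RV P >-> phase R d}) t : has_law P (law Y t) (Y t).
Proof. by []. Qed.

Lemma solution_pathwise (Y : R -> {RV P >-> phase R d}) :
  delay_mean_field_solution gamma sigma A B W Y ->
  {ae P, forall w, pathwise_solution gamma A (fun s => mean_field B (law Y s))
     (fun t => Num.sqrt (2 * sigma) *: (W t w : 'rV[R]_d))
     (fun t => (Y t w).1 : 'rV[R]_d) (fun t => (Y t w).2 : 'rV[R]_d)}.
Proof.
case=> _ _; apply: filterS => w [cX cV eqs].
have coordc (X : R -> 'rV[R]_d) : {within `[0, +oo[, continuous X} -> continuous_path X.
  move=> cX' i x; apply: (@cvg_comp _ _ _ X (fun M : 'rV[R]_d => M 0 i) _ (nbhs (X x))).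
    exact: cX'.
  exact: coord_continuous.
split; [exact: (coordc _ cX)|exact: (coordc _ cV)|]. move=> t t0. exact: (eqs t t0).
Qed.

Lemma solution_P2 (Y : R -> {RV P >-> phase R d}) t :
  delay_mean_field_solution gamma sigma A B W Y -> 0 <= t -> P2 (law Y t).
Proof. by case=> _ [h _] _; exact: h. Qed.

Lemma solution_lipschitz_field (Y : R -> {RV P >-> phase R d}) :
  delay_mean_field_solution gamma sigma A B W Y ->
  lipschitz_field c_B (fun s => mean_field B (law Y s)).
Proof.
move=> solY; split.
  by move=> x; case: solY => _ cY _; exact: (continuous_mean_field cB0 HB).
move=> s x y s0.
exact: (mean_field_lipschitz cB0 HB _ _ (@law_has_law Y s) (solution_P2 solY s0)).
Qed.

Let q t w : R := Qform gamma ((Z t w).1 - (Zh t w).1 : 'rV[R]_d)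
                             ((Z t w).2 - (Zh t w).2 : 'rV[R]_d).

Let C : R := 2 / gamma + gamma + 1.
Let K : R := 2 * gamma / (4 + gamma ^+ 2).

Let x t w : 'rV[R]_d := position (Z t) w - position (Zh t) w.
Let v t w : 'rV[R]_d := velocity (Z t) w - velocity (Zh t) w.

Let q_lower t w : enorm (x t w) ^+ 2 <= K * q t w.
Proof.
rewrite /q /Qform !sqr_enorm.
apply: Qform_bound => //; [exact: dotv_ge0|exact: dotv_ge0|exact: sqr_dotv_le].
Qed.

Let K0 : 0 < K.
Proof. by rewrite divr_gt0 ?mulr_gt0// ltr_wpDr ?sqr_ge0. Qed.

Let q_ge0 t w : 0 <= q t w.
Proof. by rewrite -(pmulr_rge0 _ K0) (le_trans _ (q_lower t w))// sqr_ge0. Qed.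

Let q_upper t w : q t w <= C * (enorm (x t w) ^+ 2 + enorm (v t w) ^+ 2).
Proof.
rewrite /q /Qform -/(x t w) -/(v t w) !sqr_enorm /C.
have := dotv_young (x t w) (v t w) ltr01; rewrite divr1 mul1r => h.
have := dotv_ge0 (x t w); have := dotv_ge0 (v t w) => v0 x0.
have : 0 <= gamma * dotv (v t w) (v t w) by rewrite mulr_ge0 ?(ltW g0).
set a := dotv (x t w) (x t w) in h x0 *; set b := dotv (v t w) (v t w) in h v0 *.
move: h; set c := dotv _ _ => h gb.
have -> : (2 / gamma + gamma + 1) * (a + b) =
  (2 / gamma + gamma) * a + (a + b) + gamma * b + 2 / gamma * b by ring.
lra.
Qed.

Let sx t : 0 <= t -> square_integrable P (x t).
Proof.
move=> t0; apply: square_integrableB.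
  exact: (P2_square_integrable (@law_has_law Z t) (solution_P2 solZ t0)).1.
exact: (P2_square_integrable (@law_has_law Zh t) (solution_P2 solZh t0)).1.
Qed.

Let sv t : 0 <= t -> square_integrable P (v t).
Proof.
move=> t0; apply: square_integrableB.
  exact: (P2_square_integrable (@law_has_law Z t) (solution_P2 solZ t0)).2.
exact: (P2_square_integrable (@law_has_law Zh t) (solution_P2 solZh t0)).2.
Qed.

Let mq t : 0 <= t -> measurable_fun setT (q t).
Proof.
move=> t0; have [mx _] := sx t0; have [mv _] := sv t0.
rewrite (_ : q t = (fun w => (2 / gamma + gamma) * dotv (x t w) (x t w)
    + 2 * dotv (x t w) (v t w) + 2 / gamma * dotv (v t w) (v t w))); last first.
  by apply/funext => w; rewrite /q /Qform !sqr_enorm.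
by repeat apply: measurable_funD; apply: measurable_funM => //; exact: measurable_dotv.
Qed.

Let bound_integrable t : 0 <= t ->
  P.-integrable setT (EFin \o (fun w => C * (enorm (x t w) ^+ 2 + enorm (v t w) ^+ 2))).
Proof.
move=> t0; have h := integrableD measurableT (integrable_sqr_enorm (sx t0)) (integrable_sqr_enorm (sv t0)).
by have := @integrableZl _ _ _ P _ measurableT C _ h.
Qed.

Let qi t : 0 <= t -> P.-integrable setT (EFin \o q t).
Proof.
move=> t0; apply: (le_integrable measurableT _ _ (bound_integrable t0)).
  by apply/measurable_EFinP; exact: mq.
move=> w _; rewrite /= lee_fin ger0_norm// (le_trans (q_upper t w))//.
exact: ler_norm.
Qed.

Let J t : R := \int[P]_w q t w.

Lemma Jfun_EFin t : 0 <= t -> Jfun gamma Z Zh t = (J t)%:E.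
Proof.
move=> t0; rewrite /Jfun unlock /J /Rintegral fineK//.
by apply: integrable_fin_num => //; exact: qi.
Qed.

Let J_ge0 t : 0 <= J t.
Proof. by apply: Rintegral_ge0 => w _; exact: q_ge0. Qed.

Let J_bounded T0 : exists M, forall t, 0 <= t <= T0 -> J t <= M.
Proof.
have [_ cZ _] := solZ; have [_ cZh _] := solZh.
have [M hM] := sqnorm2_locally_bounded T0 cZ.
have [N hN] := sqnorm2_locally_bounded T0 cZh.
exists (C * (2 * (M + N))) => t /[dup] tT /andP[t0 _].
have C0 : 0 <= C by rewrite /C !addr_ge0 ?divr_ge0 ?(ltW g0).
have h : (\int[P]_w (enorm (x t w) ^+ 2)%:E + \int[P]_w (enorm (v t w) ^+ 2)%:E
    <= (2 * (M + N))%:E)%E.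
  have mpos (Y : R -> {RV P >-> phase R d}) : measurable_rV (position (Y t)).
    by apply: measurable_rV_of; exact: measurable_position.
  have mvel (Y : R -> {RV P >-> phase R d}) : measurable_rV (velocity (Y t)).
    by apply: measurable_rV_of; exact: measurable_velocity.
  have hp := integral_sqr_enorm_le P (measurable_rVB (mpos Z) (mpos Zh)) (mpos Z) (mpos Zh) _.
  have hv := integral_sqr_enorm_le P (measurable_rVB (mvel Z) (mvel Zh)) (mvel Z) (mvel Zh) _.
  apply: (le_trans (leeD (hp _) (hv _))).
  - by move=> w; rewrite -[enorm (position (Zh t) w)]enormN sqr_enormD_le.
  - by move=> w; rewrite -[enorm (velocity (Zh t) w)]enormN sqr_enormD_le.
  have i0 (Y : T -> 'rV[R]_d) : (0 <= \int[P]_p (enorm (Y p) ^+ 2)%:E)%E.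
    by apply: integral_ge0 => p _; rewrite lee_fin sqr_ge0.
  rewrite -ge0_muleDr; try by apply: adde_ge0; exact: i0.
  rewrite EFinM lee_pmul2l// addeACA EFinD.
  rewrite -(integral_sqnorm2_law (@law_has_law Z t)) -(integral_sqnorm2_law (@law_has_law Zh t)).
  by apply: leeD; [exact: hM|exact: hN].
have le1 : J t <= \int[P]_w (C * (enorm (x t w) ^+ 2 + enorm (v t w) ^+ 2)).
  by apply: le_Rintegral => //; [exact: qi|exact: bound_integrable].
apply: (le_trans le1).
have i1 := integrable_sqr_enorm (sx t0); have i2 := integrable_sqr_enorm (sv t0).
rewrite RintegralZl//; last by have := integrableD measurableT i1 i2.
rewrite ler_wpM2l// RintegralD// /Rintegral -fineD//; try exact: integrable_fin_num.
rewrite -lee_fin fineK//.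
by rewrite fin_numD; apply/andP; split; exact: integrable_fin_num.
Qed.

Lemma Jfun_gap phi S t :
  let eta := c_g + 2 * c_B in
  let l1 := lambda1 gamma eta in
  let l2 := lambda2 gamma eta in
  0 < l1 -> 0 <= t -> 0 <= S -> averaged_ode l1 l2 (J 0) phi ->
  (forall s, 0 <= s <= t -> J s <= phi s + S) ->
  J t <= phi t + l2 / l1 * S.
Proof.
move=> eta l1 l2 l10 t0 S0 ode gap.
have eta0 : 0 <= eta by rewrite addr_ge0 ?mulr_ge0.
have [_ phi0 _] := ode.
have L0 : 0 <= l2 / l1 * S by rewrite mulr_ge0 ?divr_ge0 ?(ltW l10) ?lambda2_ge0.
set e := expR (- l1 * t).
have e0 : 0 <= e by exact: expR_ge0.
(* The deterministic part of the pathwise bound; in the mean e phi(0) cancels against e J(0). *)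
pose c := phi t - e * phi 0 + (1 - e) * (l2 / l1 * S).
have aeq : {ae P, forall w, q t w <= e * q 0 w + c}.
  apply: filterS2 (solution_pathwise solZ) (solution_pathwise solZh) => w pZ pZh.
  have := @pathwise_gronwall _ _ _ _ _ _ g0 cg0 cB0 HA _ _ _ _ _ _ _ phi (J 0) S t
    l10 t0 ode (solution_lipschitz_field solZ) (solution_lipschitz_field solZh) pZ pZh.
  rewrite -/eta -/l1 -/l2 -/e -/(q t w) -/(q 0 w) => /(_ _ _) h.
  have {}h : q t w - phi t <= e * (q 0 w - phi 0) + (1 - e) * (l2 / l1 * S).
    apply: h.
      by move=> s st; apply: le_trans (J_ge0 s) (gap s st).
    move=> s y st; have s0 : 0 <= s by case/andP: st.
    (* The two solutions themselves couple their laws, so the field gap is at most c_B^2 E|x|^2, and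
       |x|^2 <= K Q. *)
    apply: (le_trans (mean_field_gap cB0 HB y (@law_has_law Z s) (@law_has_law Zh s)
      (solution_P2 solZ s0) (solution_P2 solZh s0))).
    rewrite ler_wpM2l ?sqr_ge0//.
    apply: (@le_trans _ _ (K * J s)); last by rewrite ler_pM2l// gap.
    rewrite -RintegralZl//; last exact: qi.
    apply: le_Rintegral => //.
    - exact: integrable_sqr_enorm (sx s0).
    - by have := @integrableZl _ _ _ P _ measurableT K _ (qi s0).
    - by move=> w' _; exact: q_lower.
  move: h; rewrite /c mulrBr; lra.
have ci (k : R) := integrable_probability_cst P k.
have eqi : P.-integrable setT (EFin \o (fun w => e * q 0 w)).
  by have := @integrableZl _ _ _ P _ measurableT e _ (qi (lexx 0)).
(* c may be negative; adding |c| to both sides makes the integrands nonnegative, as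
   almost-everywhere monotonicity of the integral asks here. *)
have i1 : P.-integrable setT (EFin \o (fun w => q t w + `|c|)).
  by have := integrableD measurableT (qi t0) (ci `|c|).
have i2 : P.-integrable setT (EFin \o (fun w => e * q 0 w + (c + `|c|))).
  by have := integrableD measurableT eqi (ci (c + `|c|)).
have c0 : 0 <= c + `|c| by rewrite addrC -lerBlDr sub0r -normrN ler_norm.
have H : \int[P]_w (q t w + `|c|) <= \int[P]_w (e * q 0 w + (c + `|c|)).
  rewrite /Rintegral fine_le//; [exact: integrable_fin_num|exact: integrable_fin_num|].
  apply: ae_ge0_le_integral => //.
  - by move=> w _; rewrite lee_fin addr_ge0.
  - exact: (measurable_int _ i1).
  - by move=> w _; rewrite lee_fin addr_ge0// mulr_ge0.
  - exact: (measurable_int _ i2).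
  - by apply: filterS aeq => w h _; rewrite lee_fin addrA lerD2r.
have Rc (k : R) : \int[P]_w k = k.
  rewrite Rintegral_cst// [X in fine X](_ : _ = 1%E); last exact: probability_setT.
  by rewrite mulr1.
have El : \int[P]_w (q t w + `|c|) = J t + `|c|.
  by rewrite -[in RHS](Rc `|c|); exact: RintegralD (qi t0) (ci _).
have Er : \int[P]_w (e * q 0 w + (c + `|c|)) = e * J 0 + (c + `|c|).
  rewrite -[in RHS](Rc (c + `|c|)) -[e * J 0](RintegralZl e measurableT (qi (lexx 0))).
  exact: RintegralD eqi (ci _).
move: H; rewrite El Er (addrA (e * J 0)) lerD2r /c phi0 => /le_trans; apply.
rewrite (addrA (e * J 0)) (addrCA (e * J 0)) subrr addr0 lerD2l.
by rewrite ler_piMl// gerBl.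
Qed.

Lemma Jfun_le_averaged_ode phi t :
  let eta := c_g + 2 * c_B in
  let l1 := lambda1 gamma eta in
  let l2 := lambda2 gamma eta in
  0 < l1 -> l2 < l1 -> 0 <= t -> averaged_ode l1 l2 (fine (Jfun gamma Z Zh 0)) phi ->
  (Jfun gamma Z Zh t <= (phi t)%:E)%E.
Proof.
move=> eta l1 l2 l10 l21 t0; rewrite !Jfun_EFin// lee_fin => ode.
have [M hM] := J_bounded t.
have [cphi phi0 _] := ode.
have [N hN] := continuous_locally_bounded0 cphi t.
(* Truncation at 0 makes the supremum nonnegative, as [Jfun_gap] demands; boundedness of D comes
   from [J_bounded] and from continuity of phi. *)
pose D : set R := [set r | exists2 s, 0 <= s <= t & r = Num.max 0 (J s - phi s)].
have D0 : D !=set0 by exists (Num.max 0 (J 0 - phi 0)); exists 0; rewrite ?lexx.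
have Dsup : has_sup D.
  split=> //; exists (`|M| + (`|N| + `|phi 0|)) => _ [s /[dup] st /andP[s0 _] ->].
  rewrite ge_max !addr_ge0//= lerD//.
    by rewrite (le_trans (hM _ st))// ler_norm.
  rewrite (le_trans (ler_norm _))// normrN.
  move: s0; rewrite le_eqVlt => /orP[/eqP<-|s0]; first by rewrite lerDr.
  rewrite (@le_trans _ _ `|N|) ?lerDl// (le_trans _ (ler_norm N))// hN// s0.
  by case/andP: st.
set S := sup D.
have SD s : 0 <= s <= t -> Num.max 0 (J s - phi s) <= S.
  by move=> st; apply: sup_upper_bound => //; exists s.
have S0 : 0 <= S by apply: le_trans (SD t _); rewrite ?t0 ?lexx// le_max lexx.
have gap s : 0 <= s <= t -> J s <= phi s + S.
  by move=> /SD; rewrite ge_max lerBlDl => /andP[].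
have eta0 : 0 <= eta by rewrite addr_ge0 ?mulr_ge0.
have l20 : 0 <= l2 by exact: lambda2_ge0.
(* [Jfun_gap] is applied at every s <= t with the same S, since the supremum may not be attained. *)
have SL : S <= l2 / l1 * S.
  apply: ge_sup => // _ [s /andP[s0 st] ->].
  rewrite ge_max mulr_ge0 ?divr_ge0 ?(ltW l10)//= lerBlDl.
  apply: (Jfun_gap l10 s0 S0 ode) => r /andP[r0 rs].
  by apply: gap; rewrite r0 (le_trans rs).
have S00 : S <= 0.
  rewrite -subr_le0 in SL; move: SL; rewrite -{1}[S]mul1r -mulrBl pmulr_rle0//.
  by rewrite subr_gt0 ltr_pdivrMr// mul1r.
by apply: (le_trans (gap t _)); rewrite ?t0 ?lexx// gerDl.
Qed.

End Coupling.

Theorem mainTheorem3 (R : realType) (d : nat) (gamma sigma : R) :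
  (2 <= d)%N -> 0 < gamma -> 0 < sigma ->
  exists2 eta0 : R, 0 < eta0 &
  forall (A : 'rV[R]_d -> 'rV[R]_d) (B : 'rV[R]_d -> 'rV[R]_d -> 'rV[R]_d)
         (c_g c_B : R),
  0 <= c_g -> 0 <= c_B ->
  structuralA 1 c_g A -> structuralB c_B B ->
  let eta := c_g + 2 * c_B in
  eta < eta0 ->
  let l1 := lambda1 gamma eta in
  let l2 := lambda2 gamma eta in
  let Lambda := l2 / l1 in
  [/\ 0 < l1,
      0 <= Lambda < 1
    & forall (disp : measure_display) (T : measurableType disp)
             (P : probability T R) (W : R -> {RV P >-> Rd R d})
             (Z Zh : R -> {RV P >-> phase R d}),
      delay_mean_field_solution gamma sigma A B W Z ->
      delay_mean_field_solution gamma sigma A B W Zh ->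
      P2 (law Z 0) -> P2 (law Zh 0) ->
      let J := Jfun gamma Z Zh in
      exists phi : R -> R,
        [/\ averaged_ode l1 l2 (fine (J 0)) phi,
            forall psi : R -> R, averaged_ode l1 l2 (fine (J 0)) psi ->
              forall t : R, 0 <= t -> psi t = phi t,
            forall t : R, 0 <= t -> (J t <= (phi t)%:E)%E
          & t `^ (1 - Lambda) * phi t @[t --> +oo] -->
              l1 `^ (Lambda - 1) * inv_Gamma Lambda * fine (J 0)]].
Proof.
move=> _ g0 _; have [eta0 eta00 small] := small_eta g0.
exists eta0 => // A B c_g c_B cg0 cB0 HA HB eta eta_lt l1 l2 Lambda.
have eta_ge0 : 0 <= eta by rewrite addr_ge0 ?mulr_ge0.
have [l10 l21] := small eta eta_ge0 eta_lt.
have l20 : 0 <= l2 by exact: lambda2_ge0.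
split=> //.
  by rewrite /Lambda divr_ge0 ?(ltW l10)//= ltr_pdivrMr// mul1r.
move=> disp T P W Z Zh solZ solZh _ _ J.
have ode : averaged_ode l1 l2 (fine (J 0)) (averaged_ode_sol l1 l2 (fine (J 0))).
  by apply: averaged_ode_solP => //; rewrite l20 ltW.
exists (averaged_ode_sol l1 l2 (fine (J 0))); split=> //.
- move=> psi opsi t t0.
  exact: (averaged_ode_unique l10 l20 l21 ode opsi).
- move=> t t0; exact: (Jfun_le_averaged_ode g0 cg0 cB0 HA HB solZ solZh l10 l21 t0 ode).
- by apply: averaged_ode_sol_decay => //; rewrite l20.
Qed.
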